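(* The fundamental quandle is an invariant of linkoids: if $L$ and $L'$ are equivalent oriented linkoid diagrams, then their fundamental quandles $Q(L)$ and $Q(L')$ are isomorphic quandles.
   Context: A quandle is a set $X$ with a binary operation $\triangleright$ such that (1) $x\triangleright x=x$ for all $x$; (2) for every $y$ the map $\beta_y:X\to X$, $\beta_y(x)=x\triangleright y$, is bijective; (3) $(x\triangleright y)\triangleright z=(x\triangleright z)\triangleright(y\triangleright z)$ for all $x,y,z$. Write $x\triangleright^{-1}y=\beta_y^{-1}(x)$ and $\triangleright^{1}=\triangleright$. Quandle homomorphisms are maps preserving $\triangleright$; isomorphisms are bijective homomorphisms. An oriented $n$-linkoid diagram ($n\ge 0$) is a generic immersion into $S^2$ of $n$ unit intervals $[0,1]$ (oriented from $0$ to $1$; the open components) and a number of oriented circles (the closed components), with finitely many transverse double points (crossings), each endowed with over/under information. A linkoid diagram is an $n$-linkoid diagram for some $n$. The image of $0$ in an open component is its leg and the image of $1$ its head; these are the endpoints. Two linkoid diagrams are equivalent if one can be moved into the other by a finite sequence of isotopies (including the spherical move, i.e. isotopy in $S^2$) and oriented Reidemeister moves R1, R2, R3, all taking place away from the endpoints (endpoints may not be moved over or under a strand). A linkoid is an equivalence class of diagrams. An arc of a diagram is a maximal piece of a component containing no passage under a crossing (arcs end at undercrossings or endpoints). If $A(L)$ is the set of arcs of $L$, the fundamental quandle $Q(L)$ is the quandle presented by generators $A(L)$ and one relation $r_\tau$ for each crossing $\tau$: if $y$ is the over-arc, $x$ the incoming under-arc, $z$ the outgoing under-arc and $\varepsilon\in\{1,-1\}$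 the sign of the crossing, then $r_\tau$ is $z=x\triangleright^{\varepsilon}y$. *)

(* Defs.v *)
From HB Require Import structures.
From Stdlib Require Import Relation_Operators.
From mathcomp Require Import all_boot all_order all_algebra all_fingroup.
From mathcomp Require Import all_classical all_reals all_analysis.

Set Implicit Arguments.
Unset Strict Implicit.
Unset Printing Implicit Defensive.

Import Order.TTheory GRing.Theory Num.Theory.
Import numFieldNormedType.Exports.

Local Open Scope classical_set_scope.
Local Open Scope ring_scope.

(** * Quandles *)

Record quandle := Quandle {
  qcarrier :> Type;
  qop : qcarrier -> qcarrier -> qcarrier;
  qop_idem : forall x, qop x x = x;
  qop_bij : forall y, bijective (fun x => qop x y);
  qop_dist : forall x y z, qop (qop x y) z = qop (qop x z) (qop y z) }.

Definition quandle_iso (Q Q' : quandle) : Prop :=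
  exists2 f : Q -> Q', {morph f : x y / qop x y} & bijective f.

(** ** Quandles presented by generators and relations *)

Inductive qterm (A : Type) : Type :=
| QGen of A
| QOp of qterm A & qterm A
| QInv of qterm A & qterm A.

(* The least congruence that contains [rel] and the quandle axioms;
   [QInv x y] stands for the inverse of beta_y at x. *)
Inductive qcong (A : Type) (rel : qterm A -> qterm A -> Prop) :
  qterm A -> qterm A -> Prop :=
| qcong_rel s t : rel s t -> qcong rel s t
| qcong_refl s : qcong rel s s
| qcong_sym s t : qcong rel s t -> qcong rel t s
| qcong_trans s t u : qcong rel s t -> qcong rel t u -> qcong rel s u
| qcong_op s s' t t' : qcong rel s s' -> qcong rel t t' ->
    qcong rel (QOp s t) (QOp s' t')
| qcong_inv s s' t t' : qcong rel s s' -> qcong rel t t' ->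
    qcong rel (QInv s t) (QInv s' t')
| qcong_idem s : qcong rel (QOp s s) s
| qcong_opK s t : qcong rel (QInv (QOp s t) t) s
| qcong_invK s t : qcong rel (QOp (QInv s t) t) s
| qcong_dist s t u :
    qcong rel (QOp (QOp s t) u) (QOp (QOp s u) (QOp t u)).

Section PresentedQuandle.
Variables (A : Type) (rel : qterm A -> qterm A -> Prop).

Definition presented_carrier : Type :=
  {C : set (qterm A) | exists s, C = qcong rel s}.

Definition qclass (s : qterm A) : presented_carrier :=
  exist _ (qcong rel s) (ex_intro _ s erefl).

Lemma qclass_eq s t : qcong rel s t -> qclass s = qclass t.
Proof.
move=> st; apply: eq_exist => /=; apply/funext => u; apply/propext; split.
- by move=> su; apply: qcong_trans su; exact: qcong_sym.
- by move=> tu; apply: qcong_trans tu.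
Qed.

Lemma qclassP s t : qclass s = qclass t -> qcong rel s t.
Proof.
move=> /(congr1 (@proj1_sig _ _)) /= e.
rewrite e; exact: qcong_refl.
Qed.

Definition qrepr (C : presented_carrier) : qterm A := projT1 (cid (proj2_sig C)).

Lemma qreprK C : qclass (qrepr C) = C.
Proof.
rewrite /qrepr; case: cid => s; case: C => C CP /= Cs.
by apply: eq_exist; rewrite Cs.
Qed.

Lemma qreprP s : qcong rel (qrepr (qclass s)) s.
Proof. by apply: qclassP; rewrite qreprK. Qed.

Definition presented_op (C D : presented_carrier) : presented_carrier :=
  qclass (QOp (qrepr C) (qrepr D)).

Definition presented_inv (C D : presented_carrier) : presented_carrier :=
  qclass (QInv (qrepr C) (qrepr D)).

Lemma presented_opE s t : presented_op (qclass s) (qclass t) = qclass (QOp s t).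
Proof. by apply: qclass_eq; apply: qcong_op; exact: qreprP. Qed.

Lemma presented_invE s t :
  presented_inv (qclass s) (qclass t) = qclass (QInv s t).
Proof. by apply: qclass_eq; apply: qcong_inv; exact: qreprP. Qed.

Lemma presented_idem C : presented_op C C = C.
Proof. by rewrite -(qreprK C) presented_opE; apply/qclass_eq/qcong_idem. Qed.

Lemma presented_bij D : bijective (fun C => presented_op C D).
Proof.
exists (fun C => presented_inv C D) => C; rewrite -(qreprK C) -(qreprK D).
- by rewrite presented_opE presented_invE; apply/qclass_eq/qcong_opK.
- by rewrite presented_invE presented_opE; apply/qclass_eq/qcong_invK.
Qed.

Lemma presented_dist C D E :
  presented_op (presented_op C D) E =
  presented_op (presented_op C E) (presented_op D E).
Proof.
rewrite -(qreprK C) -(qreprK D) -(qreprK E) !presented_opE.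
exact/qclass_eq/qcong_dist.
Qed.

Definition presented_quandle : quandle :=
  Quandle presented_idem presented_bij presented_dist.

End PresentedQuandle.

(** * The sphere *)

Section Sphere.
Variable R : realType.

Definition dot (x y : 'rV[R]_3) : R := \sum_i x ord0 i * y ord0 i.

Definition sphere : set 'rV[R]_3 := [set x | dot x x = 1].

Definition det3 (u v w : 'rV[R]_3) : R :=
  \det (\matrix_(i < 3) tnth [tuple u; v; w] i).

End Sphere.

(** * Linkoid diagrams *)

(* [inl i] is the i-th open component, [inr j] the j-th closed component. *)
Definition component (n m : nat) : Type := ('I_n + 'I_m)%type.

Definition is_open_comp n m (c : component n m) : bool :=
  if c is inl _ then true else false.

Section Points.
Variables (R : realType) (n m : nat).

(* A component together with a parameter on it.  An open component is
   parametrised by [0, 1], a closed one by R modulo 1. *)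
Definition param : Type := (component n m * R)%type.

Definition in_dom (p : param) : Prop := is_open_comp p.1 -> 0 <= p.2 <= 1.

Definition not_endpoint (p : param) : Prop := is_open_comp p.1 -> 0 < p.2 < 1.

Definition same_param (p q : param) : Prop :=
  p.1 = q.1 /\
  if is_open_comp p.1 then p.2 = q.2 else exists k : int, q.2 = p.2 + k%:~R.

End Points.

Section Diagrams.
Variables (R : realType) (n m : nat).
Implicit Types (p q r : param R n m) (c : component n m).

Definition double_pair (g : component n m -> R -> 'rV[R]_3) p q : Prop :=
  [/\ in_dom p, in_dom q, ~ same_param p q & g p.1 p.2 = g q.1 q.2].

(* Immersions are of class C^1.  The curves of the open components are given
   by a C^1 extension to R, whose values outside [0, 1] play no role.
   [underpass p] says that the component passes under a crossing at [p]. *)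
Record diagram := Diagram {
  curve : component n m -> R -> 'rV[R]_3;
  underpass : set (param R n m);
  curve_derivable : forall c t, derivable (curve c) t 1;
  curve_C1 : forall c, continuous (derive1 (curve c));
  curve_sphere : forall p, in_dom p -> sphere (curve p.1 p.2);
  curve_immersion : forall p, in_dom p -> derive1 (curve p.1) p.2 != 0;
  curve_periodic : forall c t, ~~ is_open_comp c -> curve c (t + 1) = curve c t;
  double_endpoint : forall p q, double_pair curve p q -> not_endpoint p;
  double_transverse : forall p q, double_pair curve p q ->
    det3 (derive1 (curve p.1) p.2) (derive1 (curve q.1) q.2)
         (curve p.1 p.2) != 0;
  double_not_triple : forall p q r,
    double_pair curve p q -> double_pair curve p r -> same_param q r;
  double_finite :
    finite_set [set p | (exists q, double_pair curve p q) /\ 0 <= p.2 <= 1];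
  under_periodic : forall p q, same_param p q -> underpass p -> underpass q;
  under_double : forall p, underpass p -> exists q, double_pair curve p q;
  under_exactly_one : forall p q, double_pair curve p q ->
    (underpass p <-> ~ underpass q) }.

Definition crossing (L : diagram) (o u : param R n m) : Prop :=
  [/\ double_pair (curve L) o u, ~ underpass L o & underpass L u].

(* The sphere is oriented by its outward normal: the crossing is positive if
   (over direction, under direction) is a positive basis of the tangent plane. *)
Definition positive_crossing (L : diagram) (o u : param R n m) : bool :=
  0 < det3 (derive1 (curve L o.1) o.2) (derive1 (curve L u.1) u.2)
           (curve L o.1 o.2).

(** ** Arcs and the fundamental quandle *)

Definition same_arc (L : diagram) p q : Prop :=
  exists2 t, same_param (p.1, t) q &
    forall s, Num.min p.2 t <= s <= Num.max p.2 t ->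
      in_dom (p.1, s) /\ ~ underpass L (p.1, s).

Definition diagram_arc (L : diagram) : Type :=
  {a : set (param R n m) |
    exists p, [/\ in_dom p, ~ underpass L p & a = same_arc L p]}.

Definition arc_set (L : diagram) (a : diagram_arc L) :
  set (param R n m) := proj1_sig a.

Definition incoming_arc (L : diagram) p (a : diagram_arc L) : Prop :=
  \forall t \near p.2^'-, arc_set a (p.1, t).

Definition outgoing_arc (L : diagram) p (a : diagram_arc L) : Prop :=
  \forall t \near p.2^'+, arc_set a (p.1, t).

Definition crossing_relation (L : diagram) (s t : qterm (diagram_arc L)) : Prop :=
  exists (o u : param R n m) (x y z : diagram_arc L),
    [/\ crossing L o u,
        [/\ arc_set y o, incoming_arc u x & outgoing_arc u z],
        s = QGen z &
        t = if positive_crossing L o u then QOp (QGen x) (QGen y)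
            else QInv (QGen x) (QGen y)].

Definition fundamental_quandle (L : diagram) : quandle :=
  presented_quandle (@crossing_relation L).

(** * Equivalence of diagrams *)

(** ** Reparametrisation and renumbering of the components *)

Definition renumber (so : {perm 'I_n}) (sc : {perm 'I_m}) c : component n m :=
  match c with inl i => inl (so i) | inr j => inr (sc j) end.

Definition param_change (b : bool) (theta : R -> R) : Prop :=
  [/\ forall t, derivable theta t 1 /\ 0 < derive1 theta t,
      continuous (derive1 theta) &
      if b then theta 0 = 0 /\ theta 1 = 1
      else forall t, theta (t + 1) = theta t + 1].

Definition reparametrisation (L L' : diagram) : Prop :=
  exists (so : {perm 'I_n}) (sc : {perm 'I_m}) (theta : component n m -> R -> R),
    (forall c, param_change (is_open_comp c) (theta c)) /\
    forall p, in_dom p ->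
      let q := (renumber so sc p.1, theta p.1 p.2) in
      curve L' p.1 p.2 = curve L q.1 q.2 /\ (underpass L' p <-> underpass L q).

(** ** Isotopies of the sphere *)

(* A continuous path of C^1 diffeomorphisms of the sphere from the identity,
   each given by an extension to R^3 that is differentiable along the sphere;
   for instance x |-> |x| H(t, x/|x|).  Bijectivity and injectivity of the
   differential on tangent planes make each H t a diffeomorphism. *)
Definition sphere_isotopy (H : R -> 'rV[R]_3 -> 'rV[R]_3) : Prop :=
  let D := [set z : R * 'rV[R]_3 | 0 <= z.1 <= 1 /\ sphere z.2] in
  [/\ forall t : R, 0 <= t <= 1 -> set_bij (@sphere R) (@sphere R) (H t),
      forall x, sphere x -> H 0 x = x,
      forall t x, D (t, x) -> differentiable (H t) x /\
        forall v, dot x v = 0 -> v != 0 -> 'd (H t) x v != 0,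
      {within D, continuous (fun z => H z.1 z.2)} &
      forall v, {within D, continuous
        (fun z => 'd (H z.1) (z.2 : 'rV[R]_3) v : 'rV[R]_3)}].

Definition isotopy_move (L L' : diagram) : Prop :=
  exists2 H, sphere_isotopy H &
    forall p, in_dom p ->
      curve L' p.1 p.2 = H 1 (curve L p.1 p.2) /\ (underpass L' p <-> underpass L p).

(** ** Reidemeister moves *)

Definition square : set (R * R) := [set z | -1 <= z.1 <= 1 /\ -1 <= z.2 <= 1].

(* An orientation-preserving C^1 embedding of the square in the sphere. *)
Definition square_chart (phi : R * R -> 'rV[R]_3) : Prop :=
  [/\ forall z, square z -> sphere (phi z) /\ differentiable phi z,
      set_inj square phi,
      forall v, {within square, continuous (fun z => 'd phi z v : 'rV[R]_3)} &
      forall z, square z ->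
        0 < det3 ('d phi z (1, 0)) ('d phi z (0, 1)) (phi z)].

Section LocalMove.
Variable k : nat.

(* Where a tangle with k strands sits in a diagram.  The point of the j-th
   strand with tangle parameter u in [-1, 1] is at [strand_ctr j +
   strand_rad j * u] on the component [strand_comp j]; the strand is traversed
   backwards if [strand_rad j < 0].  Where distinct strands j and j' cross, j is
   under j' if [strand_height j < strand_height j']. *)
Record placement := Placement {
  tangle_chart : R * R -> 'rV[R]_3;
  strand_comp : 'I_k -> component n m;
  strand_ctr : 'I_k -> R;
  strand_rad : 'I_k -> R;
  strand_height : {perm 'I_k} }.

Definition strand_param (P : placement) (j : 'I_k) (u : R) : param R n m :=
  (strand_comp P j, strand_ctr P j + strand_rad P j * u).

Definition on_strand (P : placement) p : Prop :=
  exists j (u : R), -1 <= u <= 1 /\ same_param p (strand_param P j u).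

Definition valid_placement (P : placement) : Prop :=
  [/\ square_chart (tangle_chart P),
      forall j, strand_rad P j != 0,
      forall j (u : R), -1 <= u <= 1 -> not_endpoint (strand_param P j u) &
      forall j j' (u u' : R), -1 <= u <= 1 -> -1 <= u' <= 1 ->
        same_param (strand_param P j u) (strand_param P j' u') ->
        j = j' /\ u = u'].

Definition contains_tangle (P : placement) (sigma : k.-tuple (R -> R * R))
    (L : diagram) : Prop :=
  [/\ forall j (u : R), -1 <= u <= 1 ->
        curve L (strand_comp P j) (strand_ctr P j + strand_rad P j * u) =
        tangle_chart P (tnth sigma j u),
      forall p, in_dom p -> ~ on_strand P p ->
        ~ (tangle_chart P @` square) (curve L p.1 p.2) &
      forall (j j' : 'I_k) (u u' : R), j != j' ->
        -1 <= u <= 1 -> -1 <= u' <= 1 -> tnth sigma j u = tnth sigma j' u' ->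
        (underpass L (strand_param P j u) <->
         (strand_height P j < strand_height P j')%N)].

Definition local_move (sigma sigma' : k.-tuple (R -> R * R)) (L L' : diagram) :
    Prop :=
  exists P, [/\ valid_placement P,
    contains_tangle P sigma L, contains_tangle P sigma' L' &
    forall p, in_dom p -> ~ on_strand P p ->
      curve L' p.1 p.2 = curve L p.1 p.2 /\ (underpass L' p <-> underpass L p)].

End LocalMove.

(* Vanishes to second order at u = -1 and u = 1, and equals 1 at u = -1/2 and
   u = 1/2.  Hence the two sides of each move below are tangent at the ends of
   the strands, and all their crossings are at u = 0, -1/2 or 1/2. *)
Definition bump_fun (u : R) : R := 16 / 9 * (1 - u ^+ 2) ^+ 2.

(* The curl crosses itself at u = -1/2, 1/2.  There [contains_tangle] puts no
   condition on [underpass], so both kinds of crossing occur; the two senses of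
   rotation are obtained from the sign of [strand_rad]. *)
Definition R1_move (L L' : diagram) : Prop :=
  @local_move 1 [tuple (fun u => (u, 0))]
                [tuple (fun u => (u * (1 - bump_fun u), bump_fun u / 2))] L L'.

Definition R2_move (L L' : diagram) : Prop :=
  @local_move 2 [tuple (fun u => (u, 0)); (fun u => (u, 1 / 2))]
                [tuple (fun u => (u, 0)); (fun u => (u, (1 - bump_fun u) / 2))] L L'.

Definition R3_move (L L' : diagram) : Prop :=
  @local_move 3
    [tuple (fun u => (u, u / 2)); (fun u => (u, - u / 2));
           (fun u => (u, bump_fun u / 4))]
    [tuple (fun u => (u, u / 2)); (fun u => (u, - u / 2));
           (fun u => (u, - bump_fun u / 4))] L L'.

Definition elementary_move (L L' : diagram) : Prop :=
  reparametrisation L L' \/ isotopy_move L L' \/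
  R1_move L L' \/ R2_move L L' \/ R3_move L L'.

Definition equivalent : diagram -> diagram -> Prop :=
  clos_refl_sym_trans diagram elementary_move.

End Diagrams.

(* Main.v *)
Require Import Defs.
From mathcomp Require Import all_boot all_order all_algebra all_fingroup.
From mathcomp Require Import all_classical all_reals all_analysis.
From mathcomp Require Import lra ring zify.

Set Implicit Arguments.
Unset Strict Implicit.
Unset Printing Implicit Defensive.

Import Order.TTheory GRing.Theory Num.Theory.
Import numFieldNormedType.Exports.

Local Open Scope classical_set_scope.
Local Open Scope ring_scope.

(** Colorings of a diagram [L] by a quandle [X] are the homomorphisms from the fundamental
    quandle of [L] to [X].  By Yoneda's lemma, it suffices to show for each move that the
    colorings of the two diagrams correspond to each other, in a way that is compatible with
    homomorphisms of [X]; this compatibility is automatic when the counterpart of a coloring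
    is characterized by its values at some points ([iso_of_transfer]).  A coloring is treated
    as a function on the points of the diagram that is locally constant outside the
    underpasses and satisfies one equation at each underpass, so that a coloring of one
    diagram can be changed inside a disc and the result be checked locally.

    A reparametrisation or an isotopy matches the points of the two diagrams
    ([iso_of_diagram_map]).  The signs of the crossings are preserved: a reparametrisation
    multiplies the determinant that defines the sign by a positive number, and during an
    isotopy this determinant varies continuously without vanishing ([isotopy_sign]).

    A Reidemeister move replaces a tangle in a disc.  The strands of all the tangles are cut
    into four segments by the parameters -1/2, 0 and 1/2, and a coloring of a tangle is a
    family of colors of the segments with one equation for each breakpoint
    ([tangle_coloring]).  If the colorings of the two tangles have the same colors at the ends
    of the strands, and are determined by them, then every coloring of one diagram, restricted
    to the complement of the disc, extends in a unique way to the other diagram ([local_iso]).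

    In the second and third moves the strands are graphs over the same axis. Passing each
    breakpoint, from left to right, transforms the colors of the strands by an explicit
    formula, in which the sign of a crossing enters only through the slopes of the strands and
    the direction of the upper one.  The two tangles of a move give the same transformation
    because of the cancellation [qpowK] for the second move, and by the distributivity
    [qpow_dist] for the third.  In the first move idempotence makes every coloring of the
    curl constant ([curl_coloring]). *)

(** * Quandles and their inverse operation *)

Section QuandleOps.
Variable Q : quandle.
Implicit Types x y z : Q.

Lemma qop_surj y x : exists z, qop z y = x.
Proof. by have [g _ gK] := qop_bij y; exists (g x); rewrite gK. Qed.

Definition qinv x y : Q := projT1 (cid (qop_surj y x)).

Lemma qinvK x y : qop (qinv x y) y = x.
Proof. by rewrite /qinv; case: cid. Qed.

Lemma qop_inj y : injective (fun x => qop x y).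
Proof. exact: bij_inj (qop_bij y). Qed.

Lemma qopK x y : qinv (qop x y) y = x.
Proof. by apply: (@qop_inj y); rewrite /= qinvK. Qed.

Definition qpow (b : bool) x y : Q := if b then qop x y else qinv x y.

Lemma qpowK b x y : qpow (~~ b) (qpow b x y) y = x.
Proof. by case: b; rewrite /= ?qopK ?qinvK. Qed.

Lemma qpowNK b x y : qpow b (qpow (~~ b) x y) y = x.
Proof. by rewrite -{1}[b]negbK qpowK. Qed.

Lemma qpow_inj b y : injective (fun x => qpow b x y).
Proof. exact: (can_inj (g := fun x => qpow (~~ b) x y) (fun x => qpowK b x y)). Qed.

Lemma qpow_idem b x : qpow b x x = x.
Proof. by case: b; rewrite /= ?qop_idem // -{1}[x]qop_idem qopK. Qed.

Lemma qop_pow_dist d x y z :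
  qop (qpow d x y) z = qpow d (qop x z) (qop y z).
Proof.
case: d => /=; first exact: qop_dist.
by apply: (@qop_inj (qop y z)); rewrite /= -qop_dist !qinvK.
Qed.

(** A right translation is an automorphism, hence so is its inverse: both exponents
    distribute over both. *)
Lemma qpow_dist b d x y z :
  qpow b (qpow d x y) z = qpow d (qpow b x z) (qpow b y z).
Proof.
case: b => /=; first exact: qop_pow_dist.
by apply: (@qop_inj z); rewrite /= qop_pow_dist !qinvK.
Qed.

End QuandleOps.

Lemma morph_qpow (Q Q' : quandle) (f : Q -> Q') :
  {morph f : x y / qop x y} -> forall b, {morph f : x y / qpow b x y}.
Proof.
move=> fM [] x y //=; apply: (@qop_inj _ (f y)).
by rewrite /= -fM !qinvK.
Qed.

Lemma quandle_iso_refl (Q : quandle) : quandle_iso Q Q.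
Proof. by exists id => //; exists id. Qed.

Lemma quandle_iso_sym (Q Q' : quandle) : quandle_iso Q Q' -> quandle_iso Q' Q.
Proof.
move=> [f fM [g fK gK]]; exists g; last by exists f.
by move=> x y; apply: (can_inj fK); rewrite fM !gK.
Qed.

Lemma quandle_iso_trans (Q Q' Q'' : quandle) :
  quandle_iso Q Q' -> quandle_iso Q' Q'' -> quandle_iso Q Q''.
Proof.
move=> [f fM fb] [g gM gb]; exists (g \o f); last exact: bij_comp.
by move=> x y /=; rewrite fM gM.
Qed.

(** * The universal property of a presentation *)

Section UniversalProperty.
Variables (A : Type) (rel : qterm A -> qterm A -> Prop) (Q : quandle).

Fixpoint qeval (f : A -> Q) (t : qterm A) : Q :=
  match t with
  | QGen a => f a
  | QOp s t => qop (qeval f s) (qeval f t)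
  | QInv s t => qinv (qeval f s) (qeval f t)
  end.

Variable f : A -> Q.
Hypothesis f_rel : forall s t, rel s t -> qeval f s = qeval f t.

Lemma qeval_cong s t : qcong rel s t -> qeval f s = qeval f t.
Proof.
elim=> {s t} //=.
- by move=> s t u _ -> _ ->.
- by move=> s s' t t' _ -> _ ->.
- by move=> s s' t t' _ -> _ ->.
- by move=> s; rewrite qop_idem.
- by move=> s t; rewrite qopK.
- by move=> s t; rewrite qinvK.
- by move=> s t u; rewrite qop_dist.
Qed.

Definition presented_hom (C : presented_quandle rel) : Q := qeval f (qrepr C).

Lemma presented_homE s : presented_hom (qclass rel s) = qeval f s.
Proof. by apply: qeval_cong; exact: qreprP. Qed.

Lemma presented_homM : {morph presented_hom : x y / qop x y}.
Proof.
move=> x y; rewrite -(qreprK x) -(qreprK y) /= presented_opE.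
by rewrite !presented_homE.
Qed.

End UniversalProperty.

Lemma presented_invQ A (rel : qterm A -> qterm A -> Prop) s t :
  qclass rel (QInv s t) = qinv (qclass rel s : presented_quandle rel) (qclass rel t).
Proof.
apply: (@qop_inj (presented_quandle rel) (qclass rel t)).
apply: (etrans _ (esym (qinvK _ _))).
by rewrite /= presented_opE; apply/qclass_eq/qcong_invK.
Qed.

Lemma presented_hom_ext A (rel : qterm A -> qterm A -> Prop) (Q : quandle)
    (g h : presented_quandle rel -> Q) :
  {morph g : x y / qop x y} -> {morph h : x y / qop x y} ->
  (forall a, g (qclass rel (QGen a)) = h (qclass rel (QGen a))) -> g =1 h.
Proof.
move=> gM hM gh C; rewrite -(qreprK C).
elim: (qrepr C) => [a|s IHs t IHt|s IHs t IHt]; first exact: gh.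
- have -> : qclass rel (QOp s t) =
            qop (qclass rel s : presented_quandle rel) (qclass rel t).
    by rewrite /= presented_opE.
  by rewrite gM hM IHs IHt.
- by rewrite presented_invQ (morph_qpow gM false) (morph_qpow hM false) /= IHs IHt.
Qed.

(** * Topology of the real line *)

(** The interval is connected, and the set where [f] takes the value [f s] is open and
    closed in it. *)
Lemma locally_constant_itv (R : realType) (X : Type) (f : R -> X) (a b : R) :
  (forall s, a <= s <= b ->
     \forall t \near s, a <= t <= b -> f t = f s) ->
  forall s t, a <= s <= b -> a <= t <= b -> f s = f t.
Proof.
move=> fE s t sab tab.
set B := [set x | a <= x <= b /\ f x = f s].
suff BE : B = [set` `[a, b]].
  have : B t by rewrite BE /= in_itv.
  by case.
apply: (@segment_connected R a b).
- by exists s; split.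
- exists [set x | a <= x <= b -> f x = f s]°; first exact: open_interior.
  apply/seteqP; split => x.
    move=> [xab fx]; split; first by rewrite /= in_itv.
    have := fE _ xab; apply: filterS => y fy yab; rewrite -fx; exact: fy.
  move=> [/=]; rewrite in_itv /= => xab /nbhs_singleton; by split => //; auto.
- exists (~` [set x | a <= x <= b -> f x <> f s]°).
    by apply: open_closedC; exact: open_interior.
  apply/seteqP; split => x.
    move=> [xab fx]; split; first by rewrite /= in_itv.
    by move/nbhs_singleton => /(_ xab).
  move=> [/=]; rewrite in_itv /= => xab nx; split => //.
  apply: contrapT => fxs; apply: nx.
  have := fE _ xab; apply: filterS => y fy yab; rewrite fy //.
Qed.

Lemma finite_isolated (R : realType) (A : set R) (x : R) :
  finite_set A -> \forall y \near x^', ~ A y.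
Proof.
move=> fA; rewrite near_withinE.
have fA' : finite_set (A `\ x) by exact: finite_setD.
have cA : closed (A `\ x).
  have accR : accessible_space R by exact/hausdorff_accessible/Rhausdorff.
  exact: (iffLR accessible_finite_set_closed accR).
have : nbhs x (~` (A `\ x)).
  by apply: open_nbhs_nbhs; split; [exact: closed_openC|case=> _ /(_ erefl)].
by apply: filterS => y nA /eqP yx Ay; apply: nA.
Qed.

Lemma near_right_ex (R : realType) (x : R) (P : R -> Prop) :
  (\forall t \near x^'+, P t) -> exists t, P t.
Proof. by move=> h; exact: (@filter_ex _ _ (at_right_proper_filter x) _ h). Qed.

Lemma near_left_ex (R : realType) (x : R) (P : R -> Prop) :
  (\forall t \near x^'-, P t) -> exists t, P t.
Proof. by move=> h; exact: (@filter_ex _ _ (at_left_proper_filter x) _ h). Qed.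

(** * Parameters and double points *)

Section ParamTheory.
Variables (R : realType) (n m : nat).
Implicit Types (p q r : param R n m).

Lemma same_paramE c (s t : R) :
  same_param ((c, s) : param R n m) (c, t) =
  if is_open_comp c then s = t else exists k : int, t = s + k%:~R.
Proof.
apply/propext; split; first by case.
by rewrite /same_param.
Qed.

Lemma same_param_refl p : same_param p p.
Proof.
split=> //; case: ifP => // _; exists 0; by rewrite addr0.
Qed.

Lemma same_param_sym p q : same_param p q -> same_param q p.
Proof.
move=> [e]; rewrite /same_param -e => H; split => //; move: H; case: ifP => [//|_ [k ->]].
by exists (- k); rewrite mulrNz addrK.
Qed.

Lemma same_param_trans p q r : same_param p q -> same_param q r -> same_param p r.
Proof.
move=> [e +] [e' +]; rewrite /same_param -e' -e; case: ifP => _.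
  by move=> -> ->.
move=> [k ->] [l ->]; split => //; exists (k + l); by rewrite intrD addrA.
Qed.

(** The parameters of a point differ by a translation of the line that preserves points;
    conditions on the two sides of a point are carried from one parameter to another by it. *)
Lemma same_param_shift p q : same_param p q ->
  exists d, q = (p.1, p.2 + d) /\ forall t, same_param (p.1, t) (p.1, t + d).
Proof.
case: q => c t [/= <-]; case: ifP => [_ <-|pc [k ->]].
  by exists 0; rewrite addr0; split => // s; rewrite addr0; exact: same_param_refl.
exists k%:~R; split => // s; rewrite same_paramE pc; by exists k.
Qed.

Lemma same_param_in_dom p q : same_param p q -> in_dom p -> in_dom q.
Proof.
move=> [e +] pd; rewrite /in_dom -e => + o; rewrite o => <-; exact: pd.
Qed.

Lemma not_endpoint_in_dom p : not_endpoint p -> in_dom p.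
Proof. by move=> h o; have /andP[/ltW -> /ltW ->] := h o. Qed.

Lemma not_endpoint_near p : not_endpoint p -> \forall t \near p.2, not_endpoint (p.1, t).
Proof.
move=> h; have [po|pc] := boolP (is_open_comp p.1); last first.
  by near=> t => /= o; rewrite /= o in pc.
have : \forall t \near p.2, t \in `]0, 1[ by apply: near_in_itvoo; rewrite in_itv; exact: h.
by apply: filterS => t; rewrite in_itv => t01 _.
Unshelve. all: by end_near. Qed.

End ParamTheory.

Section DiagramTheory.
Variables (R : realType) (n m : nat) (L : diagram R n m).
Implicit Types (p q r : param R n m).

Definition on_arc p := in_dom p /\ ~ underpass L p.

Lemma on_arc_same p q : same_param p q -> on_arc p -> on_arc q.
Proof.
move=> pq [pd pu]; split; first exact: same_param_in_dom pq pd.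
move=> qu; apply: pu; apply: under_periodic qu; exact: same_param_sym.
Qed.

Lemma curve_int c t (k : int) : ~~ is_open_comp c -> curve L c (t + k%:~R) = curve L c t.
Proof.
move=> co.
have nat_case (j : nat) u : curve L c (u + j%:R) = curve L c u.
  elim: j u => [|j IH] u; first by rewrite addr0.
  by rewrite -natr1 addrA curve_periodic.
case: (intP k) => [|j|j]; first by rewrite addr0.
  exact: nat_case.
by rewrite mulrNz -[in RHS](subrK (j.+1)%:R t) nat_case.
Qed.

Lemma curve_same p q : same_param p q -> curve L p.1 p.2 = curve L q.1 q.2.
Proof.
move=> [<-]; case: ifPn => [_ -> //|co [k ->]]; by rewrite curve_int.
Qed.

Lemma double_pair_sym p q : double_pair (curve L) p q -> double_pair (curve L) q p.
Proof. by move=> [pd qd npq e]; split => // /same_param_sym. Qed.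

Lemma double_pair_same p p' q q' : same_param p p' -> same_param q q' ->
  double_pair (curve L) p q -> double_pair (curve L) p' q'.
Proof.
move=> pp qq [pd qd npq e]; split.
- exact: same_param_in_dom pp pd.
- exact: same_param_in_dom qq qd.
- move=> p'q'; apply: npq; apply: (same_param_trans pp).
  by apply: (same_param_trans p'q'); exact: same_param_sym.
- by rewrite -(curve_same pp) -(curve_same qq).
Qed.

Lemma underpass_not_endpoint p : underpass L p -> not_endpoint p.
Proof. by move=> /under_double[q]; exact: double_endpoint. Qed.

Lemma underpass_in_dom p : underpass L p -> in_dom p.
Proof. by move=> /underpass_not_endpoint/not_endpoint_in_dom. Qed.

Lemma underpass_same p q : same_param p q -> (underpass L p <-> underpass L q).
Proof.
move=> pq; split; first exact: under_periodic.
by apply: under_periodic; exact: same_param_sym.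
Qed.

(** Double points are finite in number only up to periodicity: on a closed component, a
    parameter near [p] is a parameter in [[0, 1]] up to [floor p] and a correction in
    [{-1, 0, 1}]. *)
Lemma underpass_isolated p : \forall t \near p.2^', ~ underpass L (p.1, t).
Proof.
pose D := [set t | underpass L (p.1, t) /\ 0 <= t <= 1].
have finD : finite_set D.
  apply: (@sub_finite_set _ _ (snd @`
    [set p | (exists q, double_pair (curve L) p q) /\ 0 <= p.2 <= 1])).
    by move=> t [/under_double tu t01]; exists (p.1, t).
  exact/finite_image/double_finite.
have [po|pc] := boolP (is_open_comp p.1).
  have := finite_isolated p.2 finD; apply: filterS => t nD tu; apply: nD; split=> //.
  by have := underpass_in_dom tu; exact.
pose k := Num.floor p.2.
pose E := \bigcup_(j in [set (-1 : int); 0; 1]) ((fun t => t + (k + j)%:~R) @` D).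
have finE : finite_set E.
  by apply: bigcup_finite => // j _; exact: finite_image.
have := finite_isolated p.2 finE.
have near1 : \forall t \near p.2^', `|p.2 - t| < 1.
  apply: nbhs_dnbhs; apply: (@cvgr_dist_lt _ _ _ (nbhs p.2)) => //; exact: cvg_id.
apply: filterS2 near1 => t tp nE tu; apply: nE.
have /andP[kp pk] := floor_itv p.2; rewrite -/k in kp pk.
have [j jD t01] : exists2 j : int, [set (-1 : int); 0; 1] j & 0 <= t - (k + j)%:~R <= 1.
  move: tp pk; rewrite ltr_distl intrD /= => /andP[t1 t2] pk.
  case: (ltrP t k%:~R) => tk.
    by exists (-1); [left; left|rewrite intrD (_ : (-1)%:~R = -1 :> R) //; lra].
  case: (ltrP (k%:~R + 1) t) => tk'; first by exists 1; [right|rewrite intrD; lra].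
  by exists 0; [left; right|rewrite addr0; lra].
exists j => //; exists (t - (k + j)%:~R); last by rewrite subrK.
split=> //; apply: under_periodic tu; rewrite same_paramE (negbTE pc).
by exists (- (k + j)); rewrite rmorphN.
Qed.
End DiagramTheory.

(** * Colorings of a diagram *)

Section Colorings.
Variables (R : realType) (n m : nat).
Implicit Types (L : diagram R n m) (p q r o u : param R n m) (X Y : quandle).

(** A homomorphism from the fundamental quandle to [X], seen as a function on the points of
    the diagram instead of its arcs.  All the conditions are local, so that they can be
    checked piecewise when a diagram is changed inside a disc. The values at parameters
    that are not [on_arc] are meaningless. *)
Record coloring L X (c : param R n m -> X) : Prop := Coloring {
  coloring_same : forall p q, on_arc L p -> same_param p q -> c p = c q;
  coloring_near : forall p, on_arc L p ->
    \forall t \near p.2, on_arc L (p.1, t) -> c (p.1, t) = c p;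
  coloring_crossing : forall o u, crossing L o u -> exists x z, [/\
    \forall t \near u.2^'-, c (u.1, t) = x,
    \forall t \near u.2^'+, c (u.1, t) = z &
    z = qpow (positive_crossing L o u) x (c o)] }.

Lemma coloring_arc L X (c : param R n m -> X) p q :
  coloring L c -> same_arc L p q -> c p = c q.
Proof.
move=> [csame cnear _] [t tq pt].
have gt s : Num.min p.2 t <= s <= Num.max p.2 t -> on_arc L (p.1, s) by move=> /pt.
have tI : Num.min p.2 t <= t <= Num.max p.2 t by rewrite ge_min le_max !lexx !orbT.
have pI : Num.min p.2 t <= p.2 <= Num.max p.2 t by rewrite ge_min le_max !lexx.
rewrite -(csame _ _ (gt _ tI) tq).
transitivity (c (p.1, p.2)); first by case: (p).
apply: (@locally_constant_itv R X (fun s => c (p.1, s)) _ _ _ _ _ pI tI) => s sI.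
have := cnear _ (gt _ sI); apply: filterS => s' h s'I; apply: h; exact: gt.
Qed.

Lemma coloring_morph L X Y (c : param R n m -> X) (f : X -> Y) :
  {morph f : x y / qop x y} -> coloring L c -> coloring L (f \o c).
Proof.
move=> fM [csame cnear ccross]; split.
- by move=> p q pg pq; rewrite /= (csame _ _ pg pq).
- by move=> p pg; have := cnear _ pg; apply: filterS => t h tg /=; rewrite h.
- move=> o u /ccross[x [z [cx cz e]]]; exists (f x), (f z); split.
  + by apply: filterS cx => t /= ->.
  + by apply: filterS cz => t /= ->.
  + by rewrite e (morph_qpow fM).
Qed.

(** * The universal coloring *)

Section Arcs.
Variable L : diagram R n m.

Lemma same_arc_refl p : on_arc L p -> same_arc L p p.
Proof.
move=> pg; exists p.2; first by case: p pg => c t pg; exact: same_param_refl.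
move=> s; rewrite minxx maxxx -eq_le => /eqP <-; by case: p pg.
Qed.

Lemma same_arc_on_arc p q : same_arc L p q -> on_arc L q.
Proof.
move=> [t tq /(_ t) h]; apply: (on_arc_same tq); apply: h.
by rewrite ge_min le_max !lexx !orbT.
Qed.

Lemma same_arc_seg c s t :
  (forall x, Num.min s t <= x <= Num.max s t -> on_arc L (c, x)) ->
  same_arc L (c, s) (c, t).
Proof. by move=> h; exists t => //; exact: same_param_refl. Qed.

Lemma same_arc_sym p q : same_arc L p q -> same_arc L q p.
Proof.
move=> [t tq pt].
have [d [/= qE cd]] := same_param_shift tq; rewrite qE /=.
exists (p.2 + d).
  by apply: same_param_sym; case: (p) cd => ? ? /=; exact.
move=> x xI; have /pt xg : Num.min p.2 t <= x - d <= Num.max p.2 t.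
  move: xI; rewrite minC maxC addrC [t + d]addrC [d + _]addrC [d + _]addrC.
  rewrite -addr_minl -addr_maxl; lra.
by have := on_arc_same (cd (x - d)) xg; rewrite subrK.
Qed.

Lemma same_arc_trans p q r : same_arc L p q -> same_arc L q r -> same_arc L p r.
Proof.
move=> [t tq pt] [t' tr qt].
have [d [/= qE cd]] := same_param_shift tq; rewrite qE /= in tr qt.
exists (t' - d).
  by apply: same_param_trans tr; have := cd (t' - d); rewrite subrK.
move=> x xI.
have [xpt|xpt] := boolP (Num.min p.2 t <= x <= Num.max p.2 t); first exact: pt.
have /qt xg : Num.min (t + d) t' <= x + d <= Num.max (t + d) t'.
  move: xI xpt; case: (leP p.2 t) => ?; case: (leP (t + d) t') => ?;
    case: (leP p.2 (t' - d)) => ? ? ?; lra.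
by apply: on_arc_same xg; exact/same_param_sym.
Qed.

Lemma on_arc_right p : 0 <= p.2 < 1 -> \forall t \near p.2^'+, on_arc L (p.1, t).
Proof.
move=> /andP[p0 p1].
have lt1 : \forall t \near p.2^'+, t < 1 by exact: nbhs_right_lt.
have gt0 : \forall t \near p.2^'+, p.2 < t by exact: nbhs_right_gt.
have iso : \forall t \near p.2^'+, ~ underpass L (p.1, t).
  have := underpass_isolated L p; rewrite !near_withinE.
  by apply: filterS => t h pt; apply: h; rewrite gt_eqF.
apply: filterS3 lt1 gt0 iso => t t1 t0 tu; split => // _ /=; lra.
Qed.

Lemma exists_on_arc p : exists q, on_arc L q.
Proof.
have /near_right_ex[t tg] : \forall t \near (0 : R)^'+, on_arc L (p.1, t).
  by apply: (@on_arc_right (p.1, 0)); rewrite /= lexx ltr01.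
by exists (p.1, t).
Qed.

Lemma on_arc_at_left u : not_endpoint u -> \forall t \near u.2^'-, on_arc L (u.1, t).
Proof.
move=> /not_endpoint_near ud; have := underpass_isolated L u.
rewrite !near_withinE; apply: filterS2 ud => t td h ut; split.
  exact: not_endpoint_in_dom td.
by apply: h; rewrite lt_eqF.
Qed.

Lemma on_arc_at_right u : not_endpoint u -> \forall t \near u.2^'+, on_arc L (u.1, t).
Proof.
move=> /not_endpoint_near ud; have := underpass_isolated L u.
rewrite !near_withinE; apply: filterS2 ud => t td h ut; split.
  exact: not_endpoint_in_dom td.
by apply: h; rewrite gt_eqF.
Qed.

(** Underpasses are isolated, so that the points that come shortly before [u] are all on one
    arc; this is the incoming arc when [u] is an underpass. *)
Lemma arc_at_left u : not_endpoint u ->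
  exists p, on_arc L p /\ \forall t \near u.2^'-, same_arc L p (u.1, t).
Proof.
move=> /on_arc_at_left; rewrite near_withinE => /nbhs_ballP[e /= e0 ue].
have ug t : u.2 - e < t < u.2 -> on_arc L (u.1, t).
  by move=> tI; apply: ue; rewrite /ball /= ?ltr_norml; lra.
exists (u.1, u.2 - e / 2); split; first by apply: ug; lra.
rewrite near_withinE; apply/nbhs_ballP; exists e => //= t.
rewrite /ball /= ltr_norml => tI tu; apply: same_arc_seg => x.
by rewrite ge_min le_max => xI; apply: ug; lra.
Qed.

Lemma arc_at_right u : not_endpoint u ->
  exists p, on_arc L p /\ \forall t \near u.2^'+, same_arc L p (u.1, t).
Proof.
move=> /on_arc_at_right; rewrite near_withinE => /nbhs_ballP[e /= e0 ue].
have ug t : u.2 < t < u.2 + e -> on_arc L (u.1, t).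
  by move=> tI; apply: ue; rewrite /ball /= ?ltr_norml; lra.
exists (u.1, u.2 + e / 2); split; first by apply: ug; lra.
rewrite near_withinE; apply/nbhs_ballP; exists e => //= t.
rewrite /ball /= ltr_norml => tI tu; apply: same_arc_seg => x.
by rewrite ge_min le_max => xI; apply: ug; lra.
Qed.

(** Gives the universal coloring a value at every parameter: a component has points that are
    not underpasses. *)
Definition arc_base p : param R n m :=
  if pselect (on_arc L p) then p else projT1 (cid (exists_on_arc p)).

Lemma arc_base_on_arc p : on_arc L (arc_base p).
Proof. by rewrite /arc_base; case: (pselect (on_arc L p)) => [//|npg]; case: cid. Qed.

Lemma arc_of_subproof p :
  exists q, [/\ in_dom q, ~ underpass L q & same_arc L (arc_base p) = same_arc L q].
Proof. by exists (arc_base p); case: (arc_base_on_arc p) => bd bu; split. Qed.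

Definition arc_of p : diagram_arc L :=
  exist _ (same_arc L (arc_base p)) (arc_of_subproof p).

Lemma arc_set_of p : on_arc L p -> arc_set (arc_of p) = same_arc L p.
Proof. by move=> pg; rewrite /arc_set /= /arc_base; case: pselect. Qed.

Lemma arc_ofP (a : diagram_arc L) p : arc_set a p -> a = arc_of p.
Proof.
case: a => a ha; rewrite /arc_set /= => ap; apply: eq_exist => /=.
case: ha ap => q [qd qu ->] qp.
rewrite /arc_base; case: (pselect (on_arc L p)) => [pg|/(_ (same_arc_on_arc qp))//].
apply/seteqP; split => r.
  by apply: same_arc_trans; exact: same_arc_sym.
exact: same_arc_trans.
Qed.

Lemma arc_exists (a : diagram_arc L) : exists2 p, on_arc L p & a = arc_of p.
Proof.
case: (a) (@arc_ofP a) => b [q [qd qu e]] h; exists q; first by split.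
apply: h; rewrite /arc_set /= e; exact: same_arc_refl.
Qed.

Definition universal_coloring p : fundamental_quandle L :=
  qclass (@crossing_relation _ _ _ L) (QGen (arc_of p)).

Lemma universal_coloring_arc p q :
  same_arc L p q -> on_arc L p -> universal_coloring p = universal_coloring q.
Proof.
move=> pq pg; rewrite /universal_coloring -(@arc_ofP (arc_of p) q) //.
by rewrite arc_set_of.
Qed.

Lemma universal_coloringP : coloring L universal_coloring.
Proof.
split.
- move=> p q pg pq; apply: universal_coloring_arc => //.
  exists p.2; first by case: p pq pg.
  move=> s; rewrite minxx maxxx -eq_le => /eqP <-; by case: p pg {pq}.
- move=> p pg.
  have iso := underpass_isolated L p; rewrite near_withinE in iso.
  have /nbhs_ballP[e /= e0 eu] := iso.
  apply/nbhs_ballP; exists e => //= t tp tg.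
  rewrite (@universal_coloring_arc p (p.1, t)) //.
  exists t; first exact: same_param_refl.
  move=> s sI; split.
    move=> po; have := pg.1 po; have := tg.1 po; move: sI => /=.
    by case: (leP p.2 t) => ? ? ? ?; lra.
  move: tp; rewrite /ball /= ltr_norml => tp.
  have [->|sp] := eqVneq s p.2; first by case: p pg {eu sI tp tg iso} => ? ? [].
  apply: eu => //; rewrite /ball /= ltr_norml.
  by move: sI; case: (leP p.2 t) => ? ?; lra.
- move=> o u ou; have [oup ou' uu] := ou.
  have une := underpass_not_endpoint uu.
  have [p [pg pu]] := arc_at_left une; have [q [qg qu]] := arc_at_right une.
  exists (universal_coloring p), (universal_coloring q); split.
  + by apply: filterS pu => t pt; rewrite (universal_coloring_arc pt).
  + by apply: filterS qu => t pt; rewrite (universal_coloring_arc pt).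
  have og : on_arc L o by split=> //; case: oup.
  have -> : universal_coloring q = qclass (@crossing_relation _ _ _ L)
     (if positive_crossing L o u then QOp (QGen (arc_of p)) (QGen (arc_of o))
      else QInv (QGen (arc_of p)) (QGen (arc_of o))).
    apply/qclass_eq/qcong_rel; exists o, u, (arc_of p), (arc_of o), (arc_of q).
    split=> //; split; rewrite /incoming_arc /outgoing_arc ?arc_set_of //.
    exact: same_arc_refl.
  case: ifP => _; first by rewrite /universal_coloring /= presented_opE.
  exact: presented_invQ.
Qed.

(** The image of an arc is the color of any of its points, and the condition on a coloring at
    a crossing is the relation of that crossing. *)
Lemma universal_coloring_factor X (c : param R n m -> X) : coloring L c ->
  exists2 f : fundamental_quandle L -> X, {morph f : x y / qop x y} &
    forall p, on_arc L p -> f (universal_coloring p) = c p.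
Proof.
move=> cL; have [csame cnear ccross] := cL.
pose g (a : diagram_arc L) := c (projT1 (cid (proj2_sig a))).
have gE a p : arc_set a p -> g a = c p.
  rewrite /g; have [_ _ e] := projT2 (cid (proj2_sig a)).
  by move: (projT1 _) e => q e; rewrite /arc_set e => /(coloring_arc cL).
have g_rel s t : crossing_relation s t -> qeval g s = qeval g t.
  move=> [v [u [x [y [z [uv [yv ux uz] -> ->]]]]]].
  have [x0 [z0 [cx cz e]]] := ccross _ _ uv.
  have -> : qeval g (QGen z) = z0.
    have [t' [tz <-]] := near_right_ex (filterI uz cz); exact: gE.
  have -> : qeval g (if positive_crossing L v u then QOp (QGen x) (QGen y)
      else QInv (QGen x) (QGen y)) = qpow (positive_crossing L v u) (g x) (g y).
    by case: ifP.
  have -> : g x = x0.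
    have [t' [tz <-]] := near_left_ex (filterI ux cx); exact: gE.
  by rewrite e (gE _ _ yv).
exists (presented_hom (rel := @crossing_relation _ _ _ L) g); first exact: presented_homM.
move=> p pg; rewrite /universal_coloring presented_homE //=.
by apply: gE; rewrite arc_set_of //; exact: same_arc_refl.
Qed.

Lemma universal_coloring_ext X (f g : fundamental_quandle L -> X) :
  {morph f : x y / qop x y} -> {morph g : x y / qop x y} ->
  (forall p, on_arc L p -> f (universal_coloring p) = g (universal_coloring p)) ->
  f =1 g.
Proof.
move=> fM gM fg; apply: (presented_hom_ext fM gM) => a.
by have [p pg ->] := arc_exists a; exact: fg.
Qed.

End Arcs.

(** * Isomorphisms from correspondences of colorings *)

Definition compatible (M : param R n m -> param R n m -> Prop) X
  (c c' : param R n m -> X) := forall p q, M p q -> c p = c' q.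

(** Yoneda's lemma for the functor of colorings: if every coloring of one diagram has exactly
    one counterpart on the other diagram, then the counterparts of the two universal
    colorings induce homomorphisms in both directions, and uniqueness shows that these are
    inverse to each other. Counterparts are colorings with equal values at the points that
    are related by [M]. *)
Lemma iso_of_transfer L L' (M : param R n m -> param R n m -> Prop) :
  (forall p q, M p q -> on_arc L p /\ on_arc L' q) ->
  (forall X (c : param R n m -> X), coloring L c ->
     exists2 c', coloring L' c' & compatible M c c') ->
  (forall X (c' : param R n m -> X), coloring L' c' ->
     exists2 c, coloring L c & compatible M c c') ->
  (forall X (c1 c2 c' : param R n m -> X), coloring L c1 -> coloring L c2 ->
     compatible M c1 c' -> compatible M c2 c' ->
     forall p, on_arc L p -> c1 p = c2 p) ->
  (forall X (c1 c2 c : param R n m -> X), coloring L' c1 -> coloring L' c2 ->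
     compatible M c c1 -> compatible M c c2 ->
     forall p, on_arc L' p -> c1 p = c2 p) ->
  quandle_iso (fundamental_quandle L) (fundamental_quandle L').
Proof.
move=> Mg toL' toL uniqL uniqL'.
have cL := universal_coloringP L; have cL' := universal_coloringP L'.
have [d' d'P cd'] := toL' _ _ cL; have [d dP dc'] := toL _ _ cL'.
have [f fM fE] := universal_coloring_factor d'P.
have [g gM gE] := universal_coloring_factor dP.
exists g => //; exists f.
- apply: (@universal_coloring_ext _ _ (f \o g) id) => //.
    by move=> x y /=; rewrite gM fM.
  move=> p pg; rewrite /= gE //.
  apply: (uniqL _ (f \o d) (universal_coloring L) d') => //.
    exact: coloring_morph.
  by move=> q r qr; rewrite /= (dc' _ _ qr) fE //; have [] := Mg _ _ qr.
- apply: (@universal_coloring_ext _ _ (g \o f) id) => //.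
    by move=> x y /=; rewrite fM gM.
  move=> p pg; rewrite /= fE //.
  apply: (uniqL' _ (g \o d') (universal_coloring L') d) => //.
    exact: coloring_morph.
  by move=> q r qr; rewrite /= -(cd' _ _ qr) gE //; have [] := Mg _ _ qr.
Qed.
End Colorings.

(** * Changes of parameter *)

Section ParamChange.
Variables (R : realType) (b : bool) (theta : R -> R).
Hypothesis theta_pc : param_change b theta.

Lemma param_change_continuous x : {for x, continuous theta}.
Proof.
have [h _ _] := theta_pc; have [d _] := h x.
exact/differentiable_continuous/derivable1_diffP.
Qed.

Lemma param_change_near x (P : R -> Prop) : (\forall t \near theta x, P t) ->
  \forall s \near x, P (theta s).
Proof. exact: param_change_continuous. Qed.

Lemma param_change_lt : {homo theta : x y / x < y}.
Proof.
have [h _ _] := theta_pc => x y xy.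
apply: (@gtr0_derive1_incr R theta x y) => //.
- by move=> t _; have [] := h t.
- by move=> t _; have [] := h t.
- by apply: continuous_subspaceT => t; exact: param_change_continuous.
Qed.

Lemma param_change_mono : {mono theta : x y / x < y}.
Proof. exact: leW_mono (le_mono param_change_lt). Qed.

Lemma param_change_ivt x y v : x <= y -> theta x <= v <= theta y ->
  exists2 s, x <= s <= y & theta s = v.
Proof.
move=> xy vI; have [] := @IVT R theta x y v xy.
- by apply: continuous_subspaceT => t; exact: param_change_continuous.
- move/andP: vI => [v1 v2]; apply/andP; split; first by rewrite ge_min v1.
  by rewrite le_max v2 orbT.
- by move=> s; rewrite in_itv => sI e; exists s.
Qed.

(** This stands for the continuity of the inverse of [theta], which is only defined on the
    range of [theta]. *)
Lemma param_change_open x (P : R -> Prop) : (\forall s \near x, P s) ->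
  \forall t \near theta x, exists2 s, P s & theta s = t.
Proof.
move=> /nbhs_ballP[e /= e0 eP].
have : \forall t \near theta x, t \in `]theta (x - e / 2), theta (x + e / 2)[.
  by apply: near_in_itvoo; rewrite in_itv /= !param_change_mono; apply/andP; split; lra.
apply: filterS => t; rewrite in_itv => /andP[t1 t2].
have [||s sI st] := @param_change_ivt (x - e / 2) (x + e / 2) t; first lra.
  by rewrite (ltW t1) (ltW t2).
by exists s => //; apply: eP; rewrite /ball /= ltr_norml; lra.
Qed.

Lemma param_change_int : ~~ b -> forall x (k : int), theta (x + k%:~R) = theta x + k%:~R.
Proof.
have [_ _ +] := theta_pc; case: b => // per _.
have nat_case (j : nat) x : theta (x + j%:R) = theta x + j%:R.
  elim: j x => [|j IH] x; first by rewrite !addr0.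
  by rewrite -natr1 !addrA per IH.
move=> x k; case: (intP k) => [|j|j]; first by rewrite !addr0.
  exact: nat_case.
by rewrite mulrNz -[in RHS](subrK (j.+1)%:R x) nat_case addrK.
Qed.

(** On a closed component, a period of [theta] covers the interval between [theta k] and
    [theta k + 1], and one of these intervals contains [v]. *)
Lemma param_change_surj v : (b -> 0 <= v <= 1) ->
  exists2 s, (b -> 0 <= s <= 1) & theta s = v.
Proof.
have pint := param_change_int.
have [_ _ +] := theta_pc; case: b pint => pint.
  move=> [t0 t1] /(_ isT) vI.
  have [||s sI e] := @param_change_ivt 0 1 v; rewrite ?t0 ?t1 //.
  by exists s.
move=> _ _; pose k := Num.floor (v - theta 0).
have /andP[k1 k2] := floor_itv (v - theta 0); rewrite -/k in k1 k2.
have e0 : theta k%:~R = theta 0 + k%:~R by rewrite -pint // add0r.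
have e1 : theta (k + 1)%:~R = theta 0 + (k + 1)%:~R by rewrite -pint // add0r.
have [||s sI e] := @param_change_ivt k%:~R (k + 1)%:~R v.
- by rewrite ler_int; lia.
- by rewrite e0 e1; lra.
- by exists s.
Qed.

Lemma param_change_dom v : (b -> 0 <= v <= 1) <-> (b -> 0 <= theta v <= 1).
Proof.
have [_ _ +] := theta_pc; case: b => [[t0 t1]|_]; last by split.
have le := le_mono param_change_lt.
have -> : (0 <= theta v <= 1) = (theta 0 <= theta v <= theta 1) by rewrite t0 t1.
by rewrite !le.
Qed.

End ParamChange.

(** * Diagrams that correspond point by point *)

Section DiagramMap.
Variables (R : realType) (n m : nat) (L L' : diagram R n m).
Variables (so : {perm 'I_n}) (sc : {perm 'I_m}) (theta : component n m -> R -> R).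
Hypothesis theta_pc : forall c, param_change (is_open_comp c) (theta c).
Let T (p : param R n m) : param R n m := (renumber so sc p.1, theta p.1 p.2).
Hypothesis T_under : forall p, in_dom p -> (underpass L' p <-> underpass L (T p)).
Hypothesis T_curve : forall p q, in_dom p -> in_dom q ->
  (curve L' p.1 p.2 = curve L' q.1 q.2 <->
   curve L (T p).1 (T p).2 = curve L (T q).1 (T q).2).
Hypothesis T_sign : forall p q, double_pair (curve L') p q ->
  positive_crossing L' p q = positive_crossing L (T p) (T q).
Implicit Types (p q o u : param R n m).

Lemma renumber_open c : is_open_comp (renumber so sc c) = is_open_comp c.
Proof. by case: c. Qed.

Lemma renumber_inj : injective (renumber so sc).
Proof. by move=> [i|i] [j|j] //= [] /perm_inj ->. Qed.

Lemma renumber_surj c : exists d, renumber so sc d = c.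
Proof.
case: c => i; first by exists (inl ((so^-1)%g i)); rewrite /= permKV.
by exists (inr ((sc^-1)%g i)); rewrite /= permKV.
Qed.

Lemma diagram_map_dom p : in_dom p <-> in_dom (T p).
Proof.
rewrite /in_dom /= renumber_open; exact: param_change_dom.
Qed.

Lemma diagram_map_surj q : in_dom q -> exists2 p, in_dom p & T p = q.
Proof.
case: q => c t; have [d <-] := renumber_surj c.
rewrite /in_dom /= renumber_open => /(param_change_surj (theta_pc d))[s sI e].
by exists (d, s) => //; rewrite /T /= e.
Qed.

Lemma diagram_map_inj : injective T.
Proof.
move=> [c s] [d t] [/renumber_inj <-] /(inc_inj (le_mono (param_change_lt (theta_pc c)))).
by move->.
Qed.

Lemma diagram_map_same p q : same_param p q <-> same_param (T p) (T q).
Proof.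
case: p q => c s [d t].
split; move=> [/= e]; [move: e => /= <-|move/renumber_inj: e => /= <-];
  rewrite /T /= ?same_paramE ?renumber_open; case: ifPn => co.
- by move=> ->.
- by move=> [k ->]; exists k; rewrite (param_change_int (theta_pc c)).
- by move/(inc_inj (le_mono (param_change_lt (theta_pc c)))).
- move=> [k e]; exists k; apply: (inc_inj (le_mono (param_change_lt (theta_pc c)))).
  by rewrite e (param_change_int (theta_pc c)).
Qed.

Lemma diagram_map_on_arc p : on_arc L' p <-> on_arc L (T p).
Proof.
split=> -[pd pu]; split.
- exact: (diagram_map_dom p).1 pd.
- by move=> /(T_under pd)/pu.
- exact: (diagram_map_dom p).2 pd.
- have pd' := (diagram_map_dom p).2 pd.
  by move=> pu'; apply/pu/(T_under pd').
Qed.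

Lemma diagram_map_double p q :
  double_pair (curve L') p q <-> double_pair (curve L) (T p) (T q).
Proof.
split=> -[].
- move=> pd qd npq e; split.
  + exact: (diagram_map_dom p).1 pd.
  + exact: (diagram_map_dom q).1 qd.
  + by move=> pq; apply/npq/diagram_map_same.
  + exact: (T_curve pd qd).1 e.
- move=> /(diagram_map_dom p).2 pd /(diagram_map_dom q).2 qd npq e; split=> //.
  + by move=> /(diagram_map_same p q).1/npq.
  + exact: (T_curve pd qd).2 e.
Qed.

Lemma diagram_map_crossing o u : crossing L' o u <-> crossing L (T o) (T u).
Proof.
split=> -[].
- move=> ou no uu; have [od ud _ _] := ou; split.
  + exact: (diagram_map_double o u).1 ou.
  + by move=> ov; apply/no/(T_under od).
  + exact: (T_under ud).1 uu.
- move=> /(diagram_map_double o u).2 ou no uu; have [od ud _ _] := ou; split => //.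
  + by move=> /(T_under od).1/no.
  + exact: (T_under ud).2 uu.
Qed.

Let inverse q : param R n m :=
  if pselect (exists p, T p = q) is left h then projT1 (cid h) else q.

Let inverseK p : inverse (T p) = p.
Proof.
rewrite /inverse; case: pselect => [h|[]]; last by exists p.
exact: diagram_map_inj (projT2 (cid h)).
Qed.

(** The map [T] is increasing and continuous on each component, so that it respects the
    two sides of an underpass. *)
Lemma coloring_pullback (X : quandle) (c : param R n m -> X) :
  coloring L c -> coloring L' (c \o T).
Proof.
move=> [csame cnear ccross]; split.
- move=> p q /(diagram_map_on_arc p).1 pg /(diagram_map_same p q).1 pq; exact: csame.
- move=> p /(diagram_map_on_arc p).1 pg /=.
  have := param_change_near (theta_pc p.1) (cnear _ pg).
  apply: filterS => t /= h tg; apply: h; exact: (diagram_map_on_arc (p.1, t)).1 tg.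
- move=> o u ou; have [ou' no uu] := ou.
  have [x [z [cx cz e]]] := ccross _ _ ((diagram_map_crossing _ _).1 ou).
  exists x, z; split.
  + move: cx; rewrite !near_withinE => /(param_change_near (theta_pc u.1)).
    by apply: filterS => t /= h tu; apply: h; rewrite (param_change_mono (theta_pc u.1)).
  + move: cz; rewrite !near_withinE => /(param_change_near (theta_pc u.1)).
    by apply: filterS => t /= h tu; apply: h; rewrite (param_change_mono (theta_pc u.1)).
  + by rewrite (T_sign ou').
Qed.

Lemma coloring_pushforward (X : quandle) (c : param R n m -> X) :
  coloring L' c -> coloring L (c \o inverse).
Proof.
move=> [csame cnear ccross]; split.
- move=> p q pg pq; have qg := on_arc_same pq pg.
  have [p' p'd pE] := diagram_map_surj pg.1.
  have [q' q'd qE] := diagram_map_surj qg.1.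
  rewrite /= -pE -qE !inverseK; apply: csame.
    by apply: (diagram_map_on_arc _).2; rewrite pE.
  by apply: (diagram_map_same _ _).2; rewrite pE qE.
- move=> p pg; have [p' p'd pE] := diagram_map_surj pg.1; rewrite -pE in pg *.
  have pg' := (diagram_map_on_arc _).2 pg.
  have := param_change_open (theta_pc p'.1) (cnear _ pg').
  apply: filterS => t [s sP st] tg.
  have e : (renumber so sc p'.1, t) = T (p'.1, s) by rewrite /T /= st.
  by rewrite /= e !inverseK; apply: sP; apply: (diagram_map_on_arc _).2; rewrite -e.
- move=> o u ou; have [[od ud _ _] _ _] := ou.
  have [v vd oE] := diagram_map_surj od; have [u' u'd uE] := diagram_map_surj ud.
  rewrite -oE -uE in ou *.
  have ou' := (diagram_map_crossing _ _).2 ou; have [dou _ _] := ou'.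
  have [x [z [cx cz e]]] := ccross _ _ ou'.
  exists x, z; split; last by rewrite -(T_sign dou) /= inverseK.
  + move: cx; rewrite !near_withinE => /(param_change_open (theta_pc u'.1)).
    apply: filterS => t [s sP <-]; rewrite (param_change_mono (theta_pc u'.1)) => su.
    by rewrite /= -[(_, _)]/(T (u'.1, s)) inverseK; exact: sP.
  + move: cz; rewrite !near_withinE => /(param_change_open (theta_pc u'.1)).
    apply: filterS => t [s sP <-]; rewrite (param_change_mono (theta_pc u'.1)) => su.
    by rewrite /= -[(_, _)]/(T (u'.1, s)) inverseK; exact: sP.
Qed.

(** [T] is a bijection between the points of the two diagrams that matches arcs, crossings
    and signs, so that colorings correspond by composition with [T]. *)
Lemma iso_of_diagram_map :
  quandle_iso (fundamental_quandle L) (fundamental_quandle L').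
Proof.
apply: (@iso_of_transfer _ _ _ L L' (fun q p => q = T p /\ on_arc L' p)).
- by move=> q p [-> pg]; split=> //; exact: (diagram_map_on_arc _).1.
- move=> X c cL; exists (c \o T); first exact: coloring_pullback.
  by move=> q p [-> _].
- move=> X c cL; exists (c \o inverse); first exact: coloring_pushforward.
  by move=> q p [-> _] /=; rewrite inverseK.
- move=> X c1 c2 c' _ _ h1 h2 q qg; have [p pd pE] := diagram_map_surj qg.1.
  have pg : on_arc L' p by apply: (diagram_map_on_arc _).2; rewrite pE.
  by rewrite (h1 q p) ?(h2 q p).
- by move=> X c1 c2 c _ _ h1 h2 p pg; rewrite -(h1 (T p) p) ?(h2 (T p) p).
Qed.

End DiagramMap.

(** * Determinants and derivatives of curves on the sphere *)

Section Det3.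
Variable R : realType.
Implicit Types u v w x y : 'rV[R]_3.

Local Notation i0 := (inord 0 : 'I_3).
Local Notation i1 := (inord 1 : 'I_3).
Local Notation i2 := (inord 2 : 'I_3).

Lemma sum_ord3 (F : 'I_3 -> R) : \sum_i F i = F i0 + F i1 + F i2.
Proof.
rewrite !big_ord_recl big_ord0 addr0 addrA.
by congr (F _ + F _ + F _); apply/val_inj; rewrite /= ?inordK.
Qed.

(** Links [det0P] to linear dependence of the three vectors. *)
Lemma row_lincomb3 (c : 'rV[R]_3) u v w :
  c *m (\matrix_(i < 3) tnth [tuple u; v; w] i) =
  c ord0 i0 *: u + c ord0 i1 *: v + c ord0 i2 *: w.
Proof.
apply/rowP => j; rewrite !mxE sum_ord3 !mxE.
by rewrite !(tnth_nth 0) !inordK.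
Qed.

Lemma det3E u v w : det3 u v w =
  u ord0 i0 * (v ord0 i1 * w ord0 i2 - v ord0 i2 * w ord0 i1)
  - u ord0 i1 * (v ord0 i0 * w ord0 i2 - v ord0 i2 * w ord0 i0)
  + u ord0 i2 * (v ord0 i0 * w ord0 i1 - v ord0 i1 * w ord0 i0).
Proof.
pose f (x : 'rV[R]_3) (k : nat) := x ord0 (inord k).
have fE (x : 'rV[R]_3) (i : 'I_1) (j : 'I_3) : x i j = f x (nat_of_ord j).
  by rewrite /f inord_val (ord1 i).
rewrite /det3 (expand_det_row _ ord0) !big_ord_recl big_ord0 addr0 /cofactor.
rewrite !(expand_det_row _ ord0) !big_ord_recl !big_ord0 /cofactor !det_mx11.
rewrite !mxE !(tnth_nth 0) /= !fE !inordK //= /bump /=.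
ring.
Qed.

Lemma det3Z (a b : R) u v w : det3 (a *: u) (b *: v) w = a * b * det3 u v w.
Proof. by rewrite !det3E !mxE; ring. Qed.

Lemma det3_lincomb (a b c d : R) u v w :
  det3 (a *: u + b *: v) (c *: u + d *: v) w = (a * d - b * c) * det3 u v w.
Proof. by rewrite !det3E !mxE; ring. Qed.

Lemma det3_continuous (T : topologicalType) (a b c : T -> 'rV[R]_3) :
  continuous a -> continuous b -> continuous c ->
  continuous (fun t => det3 (a t) (b t) (c t)).
Proof.
move=> ca cb cc; under eq_fun do rewrite det3E.
move=> t; have coord (f : T -> 'rV[R]_3) i : continuous f -> f s ord0 i @[s --> t] --> f t ord0 i.
  move=> cf.
  exact: (@continuous_comp _ _ _ f (fun M : 'rV[R]_3 => M ord0 i) t (cf t)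
    (@coord_continuous R 1 3 ord0 i (f t))).
by apply: cvgD; [apply: cvgB|]; apply: cvgM; try exact: coord;
  apply: cvgB; apply: cvgM; exact: coord.
Qed.

Lemma dotDr x y z : dot x (y + z) = dot x y + dot x z.
Proof. by rewrite /dot -big_split; apply: eq_bigr => i _; rewrite /= mxE mulrDr. Qed.

Lemma dotZr a x y : dot x (a *: y) = a * dot x y.
Proof. by rewrite /dot mulr_sumr; apply: eq_bigr => i _; rewrite mxE mulrCA. Qed.

(** In a linear relation between [f v], [f w] and [y], the coefficient of [y] vanishes because
    [y] is orthogonal to the other two vectors; by injectivity of [f] on the tangent plane,
    the relation then comes from one between [v] and [w]. *)
Lemma det3_tangent_neq0 (f : {linear 'rV[R]_3 -> 'rV[R]_3}) x y v w :
  sphere y ->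
  dot x v = 0 -> dot x w = 0 -> dot y (f v) = 0 -> dot y (f w) = 0 ->
  det3 v w x != 0 ->
  (forall z, dot x z = 0 -> z != 0 -> f z != 0) ->
  det3 (f v) (f w) y != 0.
Proof.
move=> yS xv xw yv yw vwx finj; apply/negP => /det0P[c c0].
rewrite row_lincomb3 => ce.
have c2 : c ord0 i2 = 0.
  have := congr1 (dot y) ce; rewrite !dotDr !dotZr yv yw yS !mulr0 !add0r mulr1 => ->.
  by rewrite /dot big1 // => i _; rewrite mxE mulr0.
have fvw : f (c ord0 i0 *: v + c ord0 i1 *: w) = 0.
  by move: ce; rewrite c2 scale0r addr0 linearD !linearZ.
have vw0 : c ord0 i0 *: v + c ord0 i1 *: w = 0.
  apply: contrapT => /eqP nz.
  have t0 : dot x (c ord0 i0 *: v + c ord0 i1 *: w) = 0.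
    by rewrite dotDr !dotZr xv xw !mulr0 addr0.
  by have := finj _ t0 nz; rewrite fvw eqxx.
move/negP: vwx; apply; apply/det0P; exists c => //.
by rewrite row_lincomb3 c2 scale0r addr0.
Qed.

End Det3.

Lemma within_continuous_slice (T U V : topologicalType) (g : T * U -> V)
    (D : set (T * U)) (I : set T) (x : U) :
  (forall t, I t -> D (t, x)) -> {within D, continuous g} ->
  {within I, continuous (fun t => g (t, x))}.
Proof.
move=> ID /subspace_continuousP gD; apply/subspace_continuousP => t It.
apply: (cvg_comp (fun s => (s, x)) g _ (gD _ (ID _ It))) => A.
rewrite /within /= => DA.
have : \forall s \near t, D (s, x) -> A (s, x).
  have ct : (fun s => (s, x)) @ t --> (t, x) by apply: cvg_pair; [exact: cvg_id|exact: cvg_cst].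
  exact: ct DA.
by apply: filterS => s h Is; apply: h; exact: ID.
Qed.

Section Calculus.
Variable R : realType.
Implicit Types (f g : R -> 'rV[R]_3).

Lemma derive1_near_eq (V : normedModType R) (f g : R -> V) t :
  (\forall s \near t, f s = g s) -> derive1 f t = derive1 g t.
Proof. by move=> fg; rewrite !derive1E; exact: near_eq_derive. Qed.

Lemma derive1_diff_comp (U V : normedModType R) (f : R -> U) (g : U -> V) t :
  derivable f t 1 -> differentiable g (f t) ->
  derive1 (g \o f) t = 'd g (f t) (derive1 f t).
Proof.
move=> /derivable1_diffP df dg.
by rewrite (derive1E' (differentiable_comp df dg)) (diff_comp df dg) (derive1E' df).
Qed.

Lemma derive1_reparam (V : normedModType R) (f : R -> V) (h : R -> R) t :
  derivable h t 1 -> derivable f (h t) 1 ->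
  derive1 (f \o h) t = derive1 h t *: derive1 f (h t).
Proof.
move=> dh /derivable1_diffP df.
rewrite (derive1_diff_comp dh df) (derive1E' df) -linearZ.
by rewrite /= /GRing.scale /= mulr1.
Qed.

Lemma derive1_coord f t i : derivable f t 1 ->
  is_derive t 1 (fun s => f s ord0 i) (derive1 f t ord0 i).
Proof.
move=> df; split; first by move/derivable_mxP: df; exact.
by rewrite derive1E derive_mx // mxE.
Qed.

(** The derivative of the constant function [dot (f s) (f s)] vanishes. *)
Lemma dot_derive1 f t : derivable f t 1 ->
  (\forall s \near t, sphere (f s)) -> dot (f t) (derive1 f t) = 0.
Proof.
move=> df fS.
pose fi i s := f s ord0 i.
have dotE : (fun s => dot (f s) (f s)) = \sum_(i < 3) (fi i * fi i).
  by apply/funext => s; rewrite fct_sumE.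
have d : is_derive t 1 (\sum_(i < 3) (fi i * fi i)) (2 * dot (f t) (derive1 f t)).
  have dfi i := @derive1_coord f t i df.
  apply: (is_derive_eq (is_derive_sum (fun i => is_deriveM (dfi i) (dfi i)))).
  rewrite mulr_sumr; apply: eq_bigr => i _.
  by rewrite -mulr2n [RHS]mulr_natl.
have : derive1 (fun s => dot (f s) (f s)) t = 0.
  rewrite (@derive1_near_eq R^o _ (cst (1 : R^o))) ?derive1_cst //.
rewrite derive1E dotE derive_val; lra.
Qed.

End Calculus.

(** * Reparametrisations and isotopies *)

Section SmoothMoves.
Variables (R : realType) (n m : nat).
Implicit Types (L : diagram R n m) (p q : param R n m).

Lemma derive1_curve_near L p (f : R -> 'rV[R]_3) : not_endpoint p ->
  (forall t, in_dom (p.1, t) -> curve L p.1 t = f t) ->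
  derive1 (curve L p.1) p.2 = derive1 f p.2.
Proof.
move=> pe Lf; apply: derive1_near_eq.
have := not_endpoint_near pe; apply: filterS => t /not_endpoint_in_dom; exact: Lf.
Qed.

Lemma reparametrisation_iso L L' : reparametrisation L L' ->
  quandle_iso (fundamental_quandle L) (fundamental_quandle L').
Proof.
move=> [so [sc [theta [thetaP LL']]]].
apply: (@iso_of_diagram_map R n m L L' so sc theta) => //.
- by move=> p /LL'[].
- by move=> p q /LL'[-> _] /LL'[-> _].
move=> p q pq; have [pd qd _ _] := pq.
have dE r : not_endpoint r -> derive1 (curve L' r.1) r.2 =
    derive1 (theta r.1) r.2 *:
      derive1 (curve L (renumber so sc r.1)) (theta r.1 r.2).
  move=> re; have [h _ _] := thetaP r.1; have [dt _] := h r.2.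
  rewrite -derive1_reparam //; last exact: curve_derivable.
  apply: derive1_curve_near => // t td; exact: (LL' _ td).1.
rewrite /positive_crossing (dE p (double_endpoint pq)).
rewrite (dE q (double_endpoint (double_pair_sym pq))) det3Z (LL' p pd).1 /=.
have [hp _ _] := thetaP p.1; have [hq _ _] := thetaP q.1.
by rewrite pmulr_rgt0 // mulr_gt0 // ?(hp p.2).2 ?(hq q.2).2.
Qed.

(** The determinant of the images of [v] and [w] at time [t] depends continuously on [t] and
    never vanishes, so that its sign at time 1 is that at time 0. *)
Lemma isotopy_sign (H : R -> 'rV[R]_3 -> 'rV[R]_3) x v w :
  sphere_isotopy H -> sphere x -> det3 v w x != 0 ->
  dot x v = 0 -> dot x w = 0 ->
  'd (H 0) x v = v -> 'd (H 0) x w = w ->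
  (forall t : R, 0 <= t <= 1 -> dot (H t x) ('d (H t) x v) = 0) ->
  (forall t : R, 0 <= t <= 1 -> dot (H t x) ('d (H t) x w) = 0) ->
  (0 < det3 ('d (H 1) x v) ('d (H 1) x w) (H 1 x)) = (0 < det3 v w x).
Proof.
move=> [Hb H0 Hd Hc Hdc] xS vw xv xw v0 w0 tv tw.
pose F t := det3 ('d (H t) x v) ('d (H t) x w) (H t x).
have Fnz t : 0 <= t <= 1 -> F t != 0.
  move=> tI; have [_ dinj] := Hd t x (conj tI xS).
  apply: (@det3_tangent_neq0 _ ('d (H t) x) x) => //.
  - by have [/(_ _ xS)] := Hb _ tI.
  - exact: tv.
  - exact: tw.
have Fc : {within `[0, 1], continuous F}.
  have ID (t : R) : `[0, 1]%classic t -> (0 <= t <= 1) /\ sphere x.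
    by rewrite /= in_itv.
  apply: det3_continuous.
  - exact: (@within_continuous_slice _ _ _
      (fun z : R * 'rV[R]_3 => 'd (H z.1) (z.2 : 'rV[R]_3) v : 'rV[R]_3) _ _ x ID (Hdc v)).
  - exact: (@within_continuous_slice _ _ _
      (fun z : R * 'rV[R]_3 => 'd (H z.1) (z.2 : 'rV[R]_3) w : 'rV[R]_3) _ _ x ID (Hdc w)).
  - exact: (@within_continuous_slice _ _ _
      (fun z : R * 'rV[R]_3 => H z.1 z.2) _ _ x ID Hc).
have -> : det3 v w x = F 0 by rewrite /F v0 w0 H0.
rewrite -/(F 1).
have I0 : 0 <= (0 : R) <= 1 by rewrite lexx ler01.
have I1 : 0 <= (1 : R) <= 1 by rewrite lexx ler01.
have := Fnz _ I0; have := Fnz _ I1; rewrite !neq_lt.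
have noroot : Num.min (F 0) (F 1) <= 0 <= Num.max (F 0) (F 1) -> False.
  move=> /(IVT ler01 Fc)[t]; rewrite in_itv /= => tI Ft.
  by have := Fnz _ tI; rewrite Ft eqxx.
move=> /orP[F1|F1] /orP[F0|F0].
- by rewrite !ltNge !ltW.
- by case: noroot; rewrite ge_min le_max (ltW F1) (ltW F0) orbT.
- by case: noroot; rewrite ge_min le_max (ltW F1) (ltW F0) orbT.
- by rewrite F0 F1.
Qed.

Lemma isotopy_iso L L' : isotopy_move L L' ->
  quandle_iso (fundamental_quandle L) (fundamental_quandle L').
Proof.
move=> [H HI LL']; have [Hb H0 Hd Hc Hdc] := HI.
have I0 : 0 <= (0 : R) <= 1 by rewrite lexx ler01.
have I1 : 0 <= (1 : R) <= 1 by rewrite lexx ler01.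
have rE p : (renumber 1%g 1%g p.1, p.2) = p.
  by case: p => -[i|i] t; rewrite /= perm1.
apply: (@iso_of_diagram_map R n m L L' 1%g 1%g (fun _ => id)).
- move=> c; split => [t||]; last by case: ifP.
    by split; [exact: derivable_id|rewrite derive1_id].
  have -> : derive1 (@id R) = cst 1 by apply/funext => t; exact: derive1_id.
  exact: cst_continuous.
- by move=> p /LL'[_]; rewrite rE.
- move=> p q pd qd; rewrite !rE (LL' p pd).1 (LL' q qd).1; split=> [|-> //].
  have [_ + _] := Hb 1 I1.
  by apply; rewrite inE; exact: curve_sphere.
move=> p q pq'; rewrite !rE; have [pd qd npq e] := pq'.
have pe := double_endpoint pq'; have qe := double_endpoint (double_pair_sym pq').
have pq : double_pair (curve L) p q.
  split => //; move: e; rewrite (LL' p pd).1 (LL' q qd).1.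
  have [_ + _] := Hb 1 I1.
  by apply; rewrite inE; exact: curve_sphere.
have xE : curve L p.1 p.2 = curve L q.1 q.2 by case: pq.
have dE r (t : R) : not_endpoint r -> 0 <= t <= 1 ->
    derive1 (H t \o curve L r.1) r.2 = 'd (H t) (curve L r.1 r.2) (derive1 (curve L r.1) r.2).
  move=> re tI; apply: derive1_diff_comp; first exact: curve_derivable.
  have [] // := Hd t (curve L r.1 r.2); split => //=.
  exact/curve_sphere/not_endpoint_in_dom.
have HtS r (t : R) : not_endpoint r -> 0 <= t <= 1 ->
    dot (H t (curve L r.1 r.2)) ('d (H t) (curve L r.1 r.2) (derive1 (curve L r.1) r.2)) = 0.
  move=> re tI; rewrite -dE //.
  apply: (@dot_derive1 R (H t \o curve L r.1)).
    apply/derivable1_diffP/differentiable_comp.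
      exact/derivable1_diffP/curve_derivable.
    have [] // := Hd t (curve L r.1 r.2); split => //=.
    exact/curve_sphere/not_endpoint_in_dom.
  have := not_endpoint_near re; apply: filterS => s /not_endpoint_in_dom rs.
  have [Hf _ _] := Hb _ tI; exact: (Hf _ (curve_sphere L rs)).
have HtT r : not_endpoint r -> dot (curve L r.1 r.2) (derive1 (curve L r.1) r.2) = 0.
  move=> re; apply: dot_derive1; first exact: curve_derivable.
  have := not_endpoint_near re; apply: filterS => s /not_endpoint_in_dom rs.
  exact: (curve_sphere L rs).
have Ht0 r : not_endpoint r ->
    'd (H 0) (curve L r.1 r.2) (derive1 (curve L r.1) r.2) = derive1 (curve L r.1) r.2.
  move=> re; rewrite -dE //; apply: derive1_near_eq.
  have := not_endpoint_near re; apply: filterS => s /not_endpoint_in_dom rs.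
  exact/H0/(curve_sphere L rs).
have L'E r : not_endpoint r -> derive1 (curve L' r.1) r.2 =
    'd (H 1) (curve L r.1 r.2) (derive1 (curve L r.1) r.2).
  move=> re; rewrite -dE //; apply: derive1_curve_near => // t td.
  exact: (LL' _ td).1.
rewrite /positive_crossing (L'E p pe) (L'E q qe) (LL' p pd).1 -xE.
apply: isotopy_sign => //.
- exact: curve_sphere.
- exact: double_transverse.
- exact: HtT.
- by rewrite xE; exact: HtT.
- exact: Ht0.
- by rewrite xE; exact: Ht0.
- by move=> t; exact: HtS.
- by rewrite xE => t; exact: HtS.
Qed.

End SmoothMoves.

(** * Segments of a strand *)

Section Breakpoints.
Variable R : realType.
Implicit Types (u w : R) (i : nat).

(** In all the tangles of the moves, the double points have the parameters -1/2, 0 and 1/2 on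
    their strands.  The four segments that these cut out of [[-1, 1]] are numbered from 0;
    a breakpoint is counted with the segment on its left, and [mid i] is a point inside the
    segment [i]. *)
Definition bp i : R := (i%:R - 1) / 2.

Definition seg u : nat := ((bp 0 < u)%R + (bp 1 < u)%R + (bp 2 < u)%R)%N.

Definition mid i : R := i%:R / 2 - 3 / 4.

Lemma bpE : (bp 0 = - (1 / 2)) * (bp 1 = 0) * (bp 2 = 1 / 2).
Proof. by rewrite /bp; split; [split|]; lra. Qed.

Lemma bp_bound i : (i < 3)%N -> - (1 / 2) <= bp i <= 1 / 2.
Proof. by case: i => [|[|[|//]]] _; rewrite bpE; lra. Qed.

Lemma seg_le3 u : (seg u <= 3)%N.
Proof. by rewrite /seg; do 3 case: (_ < _). Qed.

Lemma seg_bp i : (i < 3)%N -> seg (bp i) = i.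
Proof.
case: i => [|[|[|//]]] _; rewrite /seg !bpE; do 3 (case: ltrP => ?); rewrite //=; exfalso; lra.
Qed.

Lemma seg_low u : u <= - (1 / 2) -> seg u = 0%N.
Proof. by move=> h; rewrite /seg !bpE; do 3 (case: ltrP => ?); rewrite //=; exfalso; lra. Qed.

Lemma seg_high u : 1 / 2 < u -> seg u = 3%N.
Proof. by move=> h; rewrite /seg !bpE; do 3 (case: ltrP => ?); rewrite //=; exfalso; lra. Qed.

(** Between a point and the midpoint of its segment there is no breakpoint except possibly the
    point itself. *)
Lemma seg_between u w i : (i < 3)%N ->
  Num.min u (mid (seg u)) <= w <= Num.max u (mid (seg u)) -> w = bp i -> u = w.
Proof.
move=> i3 + wE; rewrite ge_min le_max {}wE.
case: i i3 => [|[|[|//]]] _; rewrite /seg /mid !bpE;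
  do 3 (case: ltrP => ?); rewrite /= ?addn0 ?add0n => ?; lra.
Qed.

Lemma mid_bound i : (i <= 3)%N -> - (3 / 4) <= mid i <= 3 / 4.
Proof. by case: i => [|[|[|[|//]]]] _; rewrite /mid; lra. Qed.

Lemma mid_bp i j : (i <= 3)%N -> (j < 3)%N -> mid i <> bp j.
Proof.
by case: i => [|[|[|[|//]]]] _; case: j => [|[|[|//]]] _; rewrite bpE /mid; lra.
Qed.

Lemma mid_between w i j : (i < 3)%N -> (j < 3)%N ->
  mid i <= w <= mid i.+1 -> w = bp j -> j = i.
Proof.
by case: i => [|[|[|//]]] _; case: j => [|[|[|//]]] _ //;
  rewrite bpE /mid => wI wE; exfalso; lra.
Qed.

Lemma seg_near u : \forall w \near u, seg w = seg u \/
  exists i, [/\ (i < 3)%N, u = bp i, seg w = i.+1 & seg u = i].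
Proof.
have [[i [i3 ->]]|nbp] := pselect (exists i, (i < 3)%N /\ u = bp i).
  have : \forall w \near bp i, w \in `]bp i - 1 / 4, bp i + 1 / 4[.
    by apply: near_in_itvoo; rewrite in_itv /=; lra.
  apply: filterS => w; rewrite in_itv /= => wI; rewrite seg_bp //.
  have [wi|wi] := lerP w (bp i); [left|right; exists i; split=> //; rewrite ?seg_bp //];
    move: i3 wI wi; case: i => [|[|[|//]]] _; rewrite /seg !bpE => wI wi;
    do 3 (case: ltrP => ?); rewrite //=; exfalso; lra.
have side i : (i < 3)%N -> \forall w \near u, (bp i < w) = (bp i < u).
  move=> i3; have [h|h|h] := ltrgtP (bp i) u.
  - by have := lt_nbhsr h; apply: filterS.
  - have := lt_nbhsl h; apply: filterS => w /ltW; by rewrite leNgt => /negbTE.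
  - by case: nbp; exists i.
apply: filterS3 (side 0%N isT) (side 1%N isT) (side 2%N isT) => w e0 e1 e2.
by left; rewrite /seg e0 e1 e2.
Qed.

Lemma seg_at_left i : (i < 3)%N -> \forall w \near (bp i)^'-,
  [/\ -1 <= w <= 1, seg w = i & forall i', (i' < 3)%N -> w <> bp i'].
Proof.
move=> i3; rewrite near_withinE.
have : \forall w \near bp i, w \in `]bp i - 1 / 4, bp i + 1 / 4[.
  by apply: near_in_itvoo; rewrite in_itv /=; lra.
apply: filterS => w; rewrite in_itv /= => wI wi.
case: i i3 wI wi => [|[|[|//]]] _; rewrite /seg !bpE => wI wi;
  (split; [lra|do 3 (case: ltrP => ?); rewrite //=; exfalso; lra|]);
  by case=> [|[|[|//]]] _; rewrite bpE; lra.
Qed.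

Lemma seg_at_right i : (i < 3)%N -> \forall w \near (bp i)^'+,
  [/\ -1 <= w <= 1, seg w = i.+1 & forall i', (i' < 3)%N -> w <> bp i'].
Proof.
move=> i3; rewrite near_withinE.
have : \forall w \near bp i, w \in `]bp i - 1 / 4, bp i + 1 / 4[.
  by apply: near_in_itvoo; rewrite in_itv /=; lra.
apply: filterS => w; rewrite in_itv /= => wI wi.
case: i i3 wI wi => [|[|[|//]]] _; rewrite /seg !bpE => wI wi;
  (split; [lra|do 3 (case: ltrP => ?); rewrite //=; exfalso; lra|]);
  by case=> [|[|[|//]]] _; rewrite bpE; lra.
Qed.

End Breakpoints.

(** * Neighborhoods in an affine parameter *)

Section AffineNear.
Variable R : realType.
Implicit Types (a r u w s t : R).

Lemma affine_near a r u (P : R -> Prop) : r != 0 ->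
  (\forall w \near u, P (a + r * w)) -> \forall s \near a + r * u, P s.
Proof.
move=> r0 /nbhs_ballP[e /= e0 eP]; apply/nbhs_ballP; exists (`|r| * e) => /=.
  by rewrite mulr_gt0 ?normr_gt0.
move=> s; rewrite /ball /= => sI.
have sE : s = a + r * ((s - a) / r) by rewrite mulrC divfK // addrC subrK.
rewrite sE; apply: eP; rewrite /ball /=.
rewrite -(ltr_pM2l (_ : 0 < `|r|)) ?normr_gt0 // -normrM.
by move: sI; rewrite {1}sE opprD addrACA subrr add0r -mulrBr.
Qed.

Lemma near_affine a r u (P : R -> Prop) : r != 0 ->
  (\forall s \near a + r * u, P s) -> \forall w \near u, P (a + r * w).
Proof.
move=> r0 /nbhs_ballP[e /= e0 eP]; apply/nbhs_ballP; exists (e / `|r|) => /=.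
  by rewrite divr_gt0 ?normr_gt0.
move=> w; rewrite /ball /= ltr_pdivlMr ?normr_gt0 // => wI.
apply: eP; rewrite /ball /= opprD addrACA subrr add0r -mulrBr normrM.
by rewrite mulrC.
Qed.

Lemma affine_lt a r u w : r != 0 ->
  (a + r * w < a + r * u) = (if 0 < r then w < u else u < w).
Proof.
move=> r0; rewrite ltrD2l; case: ifPn => [rp|]; first by rewrite ltr_pM2l.
by rewrite -leNgt le_eqVlt (negbTE r0) /= => rn; rewrite ltr_nM2l.
Qed.

Lemma affine_at_left a r u (P : R -> Prop) : r != 0 ->
  (\forall s \near (a + r * u)^'-, P s) <->
  (if 0 < r then \forall w \near u^'-, P (a + r * w)
   else \forall w \near u^'+, P (a + r * w)).
Proof.
move=> r0; rewrite (fun_if (fun b : Prop => b)).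
have lt w := affine_lt a u w r0.
case: ifPn lt => rp lt; split; rewrite !near_withinE.
- by move=> /(near_affine r0); apply: filterS => w; rewrite lt.
- by move=> h; apply: affine_near => //; apply: filterS h => w; rewrite lt.
- by move=> /(near_affine r0); apply: filterS => w; rewrite lt.
- by move=> h; apply: affine_near => //; apply: filterS h => w; rewrite lt.
Qed.

Lemma affine_at_right a r u (P : R -> Prop) : r != 0 ->
  (\forall s \near (a + r * u)^'+, P s) <->
  (if 0 < r then \forall w \near u^'+, P (a + r * w)
   else \forall w \near u^'-, P (a + r * w)).
Proof.
move=> r0; rewrite (fun_if (fun b : Prop => b)).
have lt w := affine_lt a w u r0.
case: ifPn lt => rp lt; split; rewrite !near_withinE.
- by move=> /(near_affine r0); apply: filterS => w; rewrite lt.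
- by move=> h; apply: affine_near => //; apply: filterS h => w; rewrite lt.
- by move=> /(near_affine r0); apply: filterS => w; rewrite lt.
- by move=> h; apply: affine_near => //; apply: filterS h => w; rewrite lt.
Qed.

Lemma near_translate t d (P : R -> Prop) : (\forall s \near t + d, P s) ->
  \forall s \near t, P (s + d).
Proof.
move=> h; have {}h : \forall s \near d + 1 * t, P s by rewrite mul1r addrC.
have := near_affine (oner_neq0 R) h; apply: filterS => s.
by rewrite mul1r addrC.
Qed.

Lemma near_dist_gt t a (e : R) : e < `|t - a| -> \forall s \near t, e < `|s - a|.
Proof.
move=> far; apply/nbhs_ballP; exists (`|t - a| - e); first by rewrite /= subr_gt0.
move=> s; rewrite /ball /= => sI; have := ler_normD (s - a) (t - s).
rewrite [s - a + _]addrC addrA subrK; move: far sI => /=; lra.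
Qed.

(** The union of the translates of an interval by the integers is closed, because only
    finitely many of them come near [t]. *)
Lemma near_off_translates t a (e : R) :
  (forall k : int, e < `|t - a - k%:~R|) ->
  \forall s \near t, forall k : int, e < `|s - a - k%:~R|.
Proof.
move=> far.
pose N := Num.bound (`|t - a| + 1 + `|e|).
have Nb : `|t - a| + 1 + `|e| < N%:R.
  by apply: archi_boundP; rewrite !addr_ge0.
have close : \forall s \near t, forall i : 'I_(N + N).+1,
    e < `|s - a - (i%:Z - N%:Z)%:~R|.
  apply: (@filter_forall R 'I_(N + N).+1
    (fun i s => e < `|s - a - (i%:Z - N%:Z)%:~R|) (nbhs t) _) => i.
  have := far (i%:Z - N%:Z); rewrite -addrA -opprD => /near_dist_gt.
  by apply: filterS => s; rewrite opprD addrA.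
have near1 : \forall s \near t, `|t - s| < 1 by apply/nbhs_ballP; exists 1 => //=.
apply: filterS2 near1 close => s s1 sfar k.
have [kN|kN] := boolP (`|k| <= N%:Z).
  have kE : 0 <= k + N%:Z by lia.
  have kI : (`|(k + N%:Z)%R|%N < (N + N).+1)%N by lia.
  have := sfar (Ordinal kI); rewrite /= (_ : `|(k + N%:Z)%R|%N%:Z - N%:Z = k) //.
  by rewrite gez0_abs // addrK.
have kN' : N%:R < `|k%:~R : R|.
  by rewrite -ltNge in kN; rewrite -intr_norm -[N%:R]/(N%:~R) ltr_int.
have h1 : `|k%:~R : R| <= `|s - a - k%:~R| + `|t - a| + `|t - s|.
  have kS : k%:~R = - (s - a - k%:~R) + ((t - a) - (t - s)) :> R by ring.
  have := ler_normD (- (s - a - k%:~R)) ((t - a) - (t - s)).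
  have := ler_normB (t - a) (t - s); rewrite -kS normrN; lra.
have := ler_norm e; lra.
Qed.

End AffineNear.

(** * Colorings of a tangle *)

(** [D j i = Some (h, i', b)] records that strand [j] passes, at its breakpoint [i], under the
    breakpoint [i'] of strand [h]; the boolean [b] is the sign that the crossing would have
    if [j] were traversed in the direction of increasing parameter. *)
Definition crossing_data k := 'I_k -> nat -> option ('I_k * nat * bool).

(** [v j i] is the color of segment [i] of strand [j], from left to right.  The relation does
    not depend on the direction of [j]: reversing [j] exchanges the incoming and the outgoing
    arc and the sign of the crossing. *)
Definition tangle_coloring k (D : crossing_data k) (X : quandle) (v : 'I_k -> nat -> X) : Prop :=
  forall j i, (i < 3)%N -> v j i.+1 =
    if D j i is Some (h, i', b) then qpow b (v j i) (v h i') else v j i.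

Section Tangles.
Variables (R : realType) (n m k : nat) (P : placement R n m k).
Hypothesis P_valid : valid_placement P.
Implicit Types (L : diagram R n m) (p q : param R n m) (j h : 'I_k) (u w : R)
  (D : crossing_data k).
Local Notation sp := (strand_param P).

Definition tangle_spec L D : Prop :=
  (forall j u, -1 <= u <= 1 ->
     underpass L (sp j u) <-> exists i, [/\ (i < 3)%N, u = bp R i & D j i]) /\
  (forall j i h i' b, (i < 3)%N -> D j i = Some (h, i', b) ->
     [/\ (i' < 3)%N, crossing L (sp h (bp R i')) (sp j (bp R i)) &
         positive_crossing L (sp h (bp R i')) (sp j (bp R i)) =
         (b == (0 < strand_rad P j))]).

Lemma strand_rad_neq0 j : strand_rad P j != 0.
Proof. by case: P_valid. Qed.

Lemma strand_in_dom j u : -1 <= u <= 1 -> in_dom (sp j u).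
Proof. by case: P_valid => _ _ h _ uI; apply: not_endpoint_in_dom; exact: h. Qed.

Lemma strand_inj j j' u u' : -1 <= u <= 1 -> -1 <= u' <= 1 ->
  same_param (sp j u) (sp j' u') -> j = j' /\ u = u'.
Proof. by case: P_valid => _ _ _; apply. Qed.

(** The part of the strands that a local move affects.  It is taken with [e = 5 / 8], between
    the breakpoints, with parameters at most [1 / 2], and the midpoints [- 3 / 4] and [3 / 4]
    at which the colors of the outer segments are read. Since the core stays away from the
    ends of the strands, nothing has to be known about the diagram near these ends. *)
Definition on_core (e : R) p : Prop :=
  exists j u, - e <= u <= e /\ same_param p (sp j u).

Lemma on_core_same e p q : same_param p q -> on_core e p -> on_core e q.
Proof.
move=> pq [j [u [uI pu]]]; exists j, u; split=> //.
by apply: same_param_trans pu; exact: same_param_sym.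
Qed.

(** For each strand, the parameters of its core form an interval up to integers, so that the
    core is closed. *)
Lemma off_core_near e p : ~ on_core e p ->
  \forall t \near p.2, ~ on_core e (p.1, t).
Proof.
move=> np.
suff : \forall t \near p.2, forall j u, - e <= u <= e -> ~ same_param (p.1, t) (sp j u).
  by apply: filterS => t h [j [u [uI pu]]]; exact: h pu.
apply: (@filter_forall R 'I_k (fun j t => forall u, - e <= u <= e ->
   ~ same_param (p.1, t) (sp j u)) (nbhs p.2) _) => j.
have [cE|cN] := eqVneq p.1 (strand_comp P j); last first.
  by apply: nearW => t u _ [/= e' _]; rewrite e' eqxx in cN.
have r0 := strand_rad_neq0 j.
set a := strand_ctr P j; set r := strand_rad P j.
have param_of_dist (t : R) (l : int) : `|t - a - l%:~R| <= `|r| * e ->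
    (is_open_comp p.1 -> l = 0) -> exists2 u, - e <= u <= e & same_param (p.1, t) (sp j u).
  move=> tl lo; exists ((t - a - l%:~R) / r).
    rewrite -ler_norml normrM normfV ler_pdivrMr ?normr_gt0 //.
    by rewrite mulrC.
  rewrite /strand_param -cE same_paramE -/a -/r [r * _]mulrC divfK //; case: ifPn => co.
    by rewrite (lo co) subr0 addrC subrK.
  by exists (- l); rewrite rmorphN /=; ring.
have dist_of_param (t : R) u : - e <= u <= e -> same_param (p.1, t) (sp j u) ->
    exists2 l : int, `|t - a - l%:~R| <= `|r| * e & (is_open_comp p.1 -> l = 0).
  move=> uI; rewrite /strand_param -cE same_paramE -/a -/r.
  have ru : `|r * u| <= `|r| * e by rewrite normrM ler_pM2l ?normr_gt0 // ler_norml.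
  case: ifPn => co.
    move=> ->; exists 0 => //.
    by rewrite (_ : a + r * u - a - 0%:~R = r * u) //; ring.
  move=> [l tl]; exists (- l) => //.
  rewrite (_ : t - a - (- l)%:~R = r * u) //.
  by move/eqP: tl; rewrite addrC -subr_eq => /eqP <-; ring.
have far (t : R) : (forall l : int, (is_open_comp p.1 -> l = 0) -> `|r| * e < `|t - a - l%:~R|) ->
    forall u, - e <= u <= e -> ~ same_param (p.1, t) (sp j u).
  move=> h u uI /(dist_of_param _ _ uI)[l tl lo]; have := h l lo; rewrite ltNge.
  by rewrite tl.
have pfar (l : int) : (is_open_comp p.1 -> l = 0) -> `|r| * e < `|p.2 - a - l%:~R|.
  move=> lo; rewrite ltNge; apply/negP => /param_of_dist/(_ lo)[u uI pu].
  by apply: np; exists j, u; split => //; case: (p) pu.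
have [co|co] := boolP (is_open_comp p.1).
  have := pfar 0 (fun _ => erefl); rewrite subr0 => /near_dist_gt.
  by apply: filterS => t tp; apply: far => l /(_ co) ->; rewrite subr0.
have /near_off_translates : forall l : int, `|r| * e < `|p.2 - a - l%:~R|.
  by move=> l; apply: pfar => o; rewrite o in co.
by apply: filterS => t tp; apply: far => l _; exact: tp.
Qed.

Section Trace.
Variables (L : diagram R n m) (D : crossing_data k) (X : quandle).
Variable c : param R n m -> X.
Hypothesis L_spec : tangle_spec L D.
Hypothesis c_coloring : coloring L c.

(** The midpoints are not breakpoints, hence lie on arcs. *)
Definition trace j i : X := c (sp j (mid R i)).

Lemma coloring_strand j x y : -1 <= x <= 1 -> -1 <= y <= 1 ->
  (forall w, Num.min x y <= w <= Num.max x y -> ~ underpass L (sp j w)) ->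
  c (sp j x) = c (sp j y).
Proof.
move=> xI yI noU.
have dom w : Num.min x y <= w <= Num.max x y -> -1 <= w <= 1.
  by case: (leP x y) => _ ?; lra.
have wg w : Num.min x y <= w <= Num.max x y -> on_arc L (sp j w).
  by move=> wI; split; [apply/strand_in_dom/dom|exact: noU].
apply: (@locally_constant_itv R X (fun w => c (sp j w)) (Num.min x y) (Num.max x y)).
- move=> w wI; have := coloring_near c_coloring (wg w wI).
  move/(near_affine (strand_rad_neq0 j)); apply: filterS => z h zI; apply: h; exact: wg.
- by rewrite ge_min le_max !lexx.
- by rewrite ge_min le_max !lexx !orbT.
Qed.

Lemma traceE j u : -1 <= u <= 1 -> ~ underpass L (sp j u) ->
  c (sp j u) = trace j (seg u).
Proof.
move=> uI noU; have mI := mid_bound R (seg_le3 u).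
apply: coloring_strand => //; first lra.
move=> w wI uw; have wI' : -1 <= w <= 1 by move: wI; case: (leP u (mid R (seg u))) => _ ?; lra.
have /(L_spec.1 _ _ wI')[i [i3 wE _]] := uw.
by apply: noU; rewrite (seg_between i3 wI wE).
Qed.

(** If strand [j] is traversed backwards, then the segment [i] is on the outgoing side; the
    relation at the crossing is inverted, and so is its sign. *)
Lemma trace_tangle_coloring : tangle_coloring D trace.
Proof.
move=> j i i3.
have mI := mid_bound R (ltnW i3 : (i <= 3)%N); have mI' := mid_bound R (i3 : (i.+1 <= 3)%N).
case Dji : (D j i) => [[[h i'] b]|]; last first.
  apply/esym/coloring_strand; [lra|lra|] => w wI uw.
  have mm : mid R i <= mid R i.+1 by rewrite /mid -[i.+1%:R]natr1; lra.
  have wI' : mid R i <= w <= mid R i.+1 by move: wI; rewrite minEle maxEle mm.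
  have w1 : -1 <= w <= 1 by lra.
  have /(L_spec.1 _ _ w1)[i' [i'3 wE]] := uw.
  by rewrite (mid_between i3 i'3 wI' wE) Dji.
have [i'3 ou posE] := L_spec.2 _ _ _ _ _ i3 Dji.
have [x [z [cx cz e]]] := coloring_crossing c_coloring ou.
have bI := bp_bound R i3; have b'I := bp_bound R i'3.
have oE : c (sp h (bp R i')) = trace h i'.
  by rewrite traceE ?seg_bp //; [lra|case: ou].
rewrite oE posE in e.
have r0 := strand_rad_neq0 j.
have notunder w : -1 <= w <= 1 -> (forall i', (i' < 3)%N -> w <> bp R i') ->
    ~ underpass L (sp j w).
  by move=> wI wn /(L_spec.1 _ _ wI)[i'' [i''3 wE _]]; exact: wn i''3 wE.
have left y : (\forall w \near (bp R i)^'-, c (sp j w) = y) -> trace j i = y.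
  move=> cy; have [w [[wI sw wn] <-]] := near_left_ex (filterI (seg_at_left R i3) cy).
  by rewrite traceE ?sw //; exact: notunder.
have right y : (\forall w \near (bp R i)^'+, c (sp j w) = y) -> trace j i.+1 = y.
  move=> cy; have [w [[wI sw wn] <-]] := near_right_ex (filterI (seg_at_right R i3) cy).
  by rewrite traceE ?sw //; exact: notunder.
move: cx cz => /(affine_at_left _ _ _ r0) + /(affine_at_right _ _ _ r0).
case: ifPn e => rp e cx cz.
- by rewrite (left _ cx) (right _ cz) e eqb_id.
- by rewrite (left _ cz) (right _ cx) e -{1}[b]negbK eqbF_neg qpowK.
Qed.

End Trace.

End Tangles.

(** * Recoloring a disc *)

Section SignInvariance.
Variables (R : realType) (n m : nat) (L : diagram R n m).
Implicit Types (p q o u : param R n m).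

Lemma derive1_curve_same p q : same_param p q ->
  derive1 (curve L p.1) p.2 = derive1 (curve L q.1) q.2.
Proof.
move=> pq; have [d [-> pd]] := same_param_shift pq => /=.
have cE t : curve L p.1 (t + d) = curve L p.1 t by rewrite -(curve_same L (pd t)).
rewrite /derive1.
suff -> : (fun h : R => h^-1 *: (curve L p.1 (h + (p.2 + d)) - curve L p.1 (p.2 + d))) =
    fun h : R => h^-1 *: (curve L p.1 (h + p.2) - curve L p.1 p.2) by [].
by apply/funext => h; rewrite addrA !cE.
Qed.

Lemma positive_crossing_same o o' u u' : same_param o o' -> same_param u u' ->
  positive_crossing L o u = positive_crossing L o' u'.
Proof.
move=> oo uu; rewrite /positive_crossing (derive1_curve_same oo) (derive1_curve_same uu).
by rewrite (curve_same L oo).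
Qed.

End SignInvariance.

Section LocalChange.
Variables (R : realType) (n m k : nat) (P : placement R n m k).
Hypothesis P_valid : valid_placement P.
Variables (L L' : diagram R n m) (D D' : crossing_data k).
Hypothesis L_spec : tangle_spec P L D.
Hypothesis L'_spec : tangle_spec P L' D'.
Hypothesis off_strand : forall p, in_dom p -> ~ on_strand P p ->
  curve L' p.1 p.2 = curve L p.1 p.2 /\ (underpass L' p <-> underpass L p).
Hypothesis L'_sep : forall p q, double_pair (curve L') p q ->
  on_strand P p -> on_strand P q.
Local Notation sp := (strand_param P).
Local Notation core := (on_core P (5 / 8)).
Implicit Types (p q o u : param R n m) (j : 'I_k) (w : R).

Lemma off_core_strand p : ~ core p -> on_strand P p ->
  exists j w, [/\ -1 <= w <= 1, same_param p (sp j w) & forall i, (i < 3)%N -> w <> bp R i].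
Proof.
move=> np [j [w [wI pw]]]; exists j, w; split=> // i i3 wE; apply: np.
by exists j, w; split => //; rewrite wE; have := bp_bound R i3; lra.
Qed.

(** On the outer segments of the strands neither diagram has a crossing, and off the strands
    the diagrams agree. *)
Lemma off_core_under p : in_dom p -> ~ core p ->
  (underpass L p <-> underpass L' p).
Proof.
move=> pd np; have [ps|ps] := pselect (on_strand P p); last first.
  by have [_ e] := off_strand pd ps; split => /e.
have [j [w [wI pw wn]]] := off_core_strand np ps.
have no (K : diagram R n m) E : tangle_spec P K E -> ~ underpass K p.
  move=> KE /(underpass_same K pw).1 /(KE.1 _ _ wI)[i [i3 wE _]].
  exact: wn i3 wE.
by split => /no; [case/(_ _ L_spec)|case/(_ _ L'_spec)].
Qed.

Lemma off_core_on_arc p : ~ core p -> on_arc L p <-> on_arc L' p.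
Proof.
by move=> np; split=> -[pd pu]; split => // /(off_core_under pd np).
Qed.

Variables (X : quandle) (c : param R n m -> X) (v' : 'I_k -> nat -> X).
Hypothesis c_coloring : coloring L c.
Hypothesis v'_coloring : tangle_coloring D' v'.
Hypothesis v'_in : forall j, v' j 0 = trace P c j 0.
Hypothesis v'_out : forall j, v' j 3 = trace P c j 3.

Definition recolor p : X :=
  if pselect (exists ju : 'I_k * R, - (5 / 8) <= ju.2 <= 5 / 8 /\ same_param p (sp ju.1 ju.2))
    is left h then v' (projT1 (cid h)).1 (seg (projT1 (cid h)).2) else c p.

Lemma recolor_off p : ~ core p -> recolor p = c p.
Proof.
rewrite /recolor; case: pselect => // -[[j w] [wI pw]] []; by exists j, w.
Qed.

Lemma recolor_strand p j w : -1 <= w <= 1 -> same_param p (sp j w) ->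
  recolor p = if (- (5 / 8) <= w <= 5 / 8) then v' j (seg w) else c p.
Proof.
move=> wI pw; rewrite /recolor; case: pselect => [h|h].
  have := projT2 (cid h); case: (projT1 _) => j' w' /= [w'I pw'].
  have w'1 : -1 <= w' <= 1 by lra.
  have ww := same_param_trans (same_param_sym pw) pw'.
  by have [-> ->] := strand_inj P_valid wI w'1 ww; rewrite w'I.
by case: ifP => // w5; case: h; exists (j, w).
Qed.

(** On the outer segments the colors of [v'] are those of [c], so that the formula for the core
    holds on the whole strands. *)
Lemma recolorE j w : -1 <= w <= 1 -> recolor (sp j w) = v' j (seg w).
Proof.
move=> wI; rewrite (recolor_strand wI (same_param_refl _)); case: ifPn => // w5.
have nbp i : (i < 3)%N -> w <> bp R i.
  by move=> i3 wE; have := bp_bound R i3; rewrite -wE; move: w5; lra.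
have nu : ~ underpass L (sp j w).
  by move=> /(L_spec.1 _ _ wI)[i [i3 wE _]]; exact: nbp i3 wE.
rewrite (traceE P_valid L_spec c_coloring wI nu).
have [w1|w1] := lerP w (- (1 / 2)); first by rewrite seg_low.
by rewrite seg_high; [rewrite v'_out|move: w5; lra].
Qed.

Lemma recolor_same p q : on_arc L' p -> same_param p q -> recolor p = recolor q.
Proof.
move=> pg pq; have [[j [w [wI pw]]]|np] := pselect (core p).
  have w1 : -1 <= w <= 1 by lra.
  have qw := same_param_trans (same_param_sym pq) pw.
  by rewrite (recolor_strand w1 pw) (recolor_strand w1 qw) wI.
have nq : ~ core q by move=> /(on_core_same (same_param_sym pq)).
rewrite !recolor_off //; apply: (coloring_same c_coloring) => //.
exact/off_core_on_arc.
Qed.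

(** The index of the segment is locally constant except at breakpoints, and a breakpoint on an
    arc is not an underpass, hence [v'] takes the same color on both of its sides. *)
Lemma recolor_near_strand j w : -1 < w < 1 -> on_arc L' (sp j w) ->
  \forall s \near (sp j w).2, on_arc L' ((sp j w).1, s) ->
    recolor ((sp j w).1, s) = recolor (sp j w).
Proof.
move=> wI [wd wu]; apply: affine_near; first exact: strand_rad_neq0.
have w1 : -1 <= w <= 1 by lra.
have : \forall z \near w, z \in `]-1, 1[ by apply: near_in_itvoo; rewrite in_itv.
apply: filterS2 (seg_near w) => z sz; rewrite in_itv /= => zI zg.
rewrite -/(strand_param P j z) !recolorE //; last lra.
case: sz => [-> //|[i [i3 wE -> ->]]].
rewrite v'_coloring //; case Dji : (D' j i) => [a|] //; case: wu.
by apply/(L'_spec.1 _ _ w1); exists i; rewrite Dji.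
Qed.

Lemma recolor_near p : on_arc L' p ->
  \forall t \near p.2, on_arc L' (p.1, t) -> recolor (p.1, t) = recolor p.
Proof.
move=> pg.
have [[j [w [wI pw]]]|np] := pselect (exists j w, -1 < w < 1 /\ same_param p (sp j w)).
  have := recolor_near_strand wI (on_arc_same pw pg); rewrite -(recolor_same pg pw).
  have [d [-> pd]] := same_param_shift pw => /near_translate.
  apply: filterS => t h tg; rewrite (recolor_same tg (pd t)); apply: h.
  exact: on_arc_same (pd t) tg.
have nc : ~ core p.
  by move=> [j [w [wI pw]]]; apply: np; exists j, w; split => //; lra.
have := coloring_near c_coloring ((off_core_on_arc nc).2 pg).
apply: filterS2 (off_core_near P_valid nc) => t tn h tg.
by rewrite !recolor_off //; apply: h; exact/off_core_on_arc.
Qed.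

Lemma recolor_crossing_strand o u : crossing L' o u -> on_strand P u ->
  exists x z, [/\ \forall t \near u.2^'-, recolor (u.1, t) = x,
    \forall t \near u.2^'+, recolor (u.1, t) = z &
    z = qpow (positive_crossing L' o u) x (recolor o)].
Proof.
move=> ou [j [w [wI uw]]]; have [oud no uu] := ou.
have /(L'_spec.1 _ _ wI)[i [i3 wE]] := (underpass_same L' uw).1 uu.
case Dji : (D' j i) => [[[h i'] b]|] // _; rewrite {}wE in wI uw.
have [i'3 hj posE] := L'_spec.2 _ _ _ _ _ i3 Dji; have [hjd hn _] := hj.
have ow : same_param o (sp h (bp R i')).
  apply: (double_not_triple _ (double_pair_sym hjd)).
  by apply/double_pair_sym/(double_pair_same (same_param_refl o) uw).
have og : on_arc L' o by split => //; case: oud.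
have r0 := strand_rad_neq0 P_valid j.
have oE : recolor o = v' h i'.
  by rewrite (recolor_same og ow) recolorE ?seg_bp //; have := bp_bound R i'3; lra.
have leftE : \forall w \near (bp R i)^'-, recolor (sp j w) = v' j i.
  by apply: filterS (seg_at_left R i3) => z [zI <- _]; exact: recolorE.
have rightE : \forall w \near (bp R i)^'+, recolor (sp j w) = v' j i.+1.
  by apply: filterS (seg_at_right R i3) => z [zI <- _]; exact: recolorE.
exists (if 0 < strand_rad P j then v' j i else v' j i.+1).
exists (if 0 < strand_rad P j then v' j i.+1 else v' j i).
have une := underpass_not_endpoint uu.
have [d [uE ud]] := same_param_shift uw.
have dE : (sp j (bp R i)).2 = u.2 + d by rewrite uE.
have cE : (sp j (bp R i)).1 = u.1 by rewrite uE.
split.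
- have : \forall s \near (sp j (bp R i)).2^'-, recolor ((sp j (bp R i)).1, s) =
      if 0 < strand_rad P j then v' j i else v' j i.+1.
    apply: (affine_at_left _ _ _ r0).2.
    by case: (0 < _); [exact: leftE|exact: rightE].
  rewrite dE cE; have := on_arc_at_left L' une; rewrite !near_withinE => ug /near_translate.
  apply: filterS2 ug => t tg tE tu.
  by rewrite (recolor_same (tg tu) (ud t)) tE // ltrD2r.
- have : \forall s \near (sp j (bp R i)).2^'+, recolor ((sp j (bp R i)).1, s) =
      if 0 < strand_rad P j then v' j i.+1 else v' j i.
    apply: (affine_at_right _ _ _ r0).2.
    by case: (0 < _); [exact: rightE|exact: leftE].
  rewrite dE cE; have := on_arc_at_right L' une; rewrite !near_withinE => ug /near_translate.
  apply: filterS2 ug => t tg tE tu.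
  by rewrite (recolor_same (tg tu) (ud t)) tE // ltrD2r.
rewrite (positive_crossing_same L' ow uw) posE oE v'_coloring // Dji.
by case: ifP => _; rewrite ?eqb_id // eqbF_neg qpowK.
Qed.

Lemma off_strand_derive p : not_endpoint p -> ~ on_strand P p ->
  derive1 (curve L' p.1) p.2 = derive1 (curve L p.1) p.2.
Proof.
move=> pe ps; apply: derive1_near_eq.
have := off_core_near P_valid (e := 1) ps.
apply: filterS2 (not_endpoint_near pe) => t /not_endpoint_in_dom td tn.
by have [] := off_strand td tn.
Qed.

Lemma recolor_crossing_off o u : crossing L' o u -> ~ on_strand P u ->
  exists x z, [/\ \forall t \near u.2^'-, recolor (u.1, t) = x,
    \forall t \near u.2^'+, recolor (u.1, t) = z &
    z = qpow (positive_crossing L' o u) x (recolor o)].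
Proof.
move=> ou us; have [oud no uu] := ou; have [od ud nou oue] := oud.
have os : ~ on_strand P o by move=> /(L'_sep oud).
have nc p : ~ on_strand P p -> ~ core p.
  by move=> ps [j [w [wI pw]]]; apply: ps; exists j, w; split => //; lra.
have [oc ov] := off_strand od os; have [uc uv] := off_strand ud us.
have ou' : crossing L o u.
  split; [split => //; by rewrite -oc -uc|by move/ov|exact: uv.1].
have [x [z [cx cz e]]] := coloring_crossing c_coloring ou'.
have un := off_core_near P_valid (nc u us).
exists x, z; split.
- move: cx; rewrite !near_withinE; apply: filterS2 un => t tn h tu.
  by rewrite recolor_off // h.
- move: cz; rewrite !near_withinE; apply: filterS2 un => t tn h tu.
  by rewrite recolor_off // h.
rewrite recolor_off ?e; last exact: nc.
congr qpow; rewrite /positive_crossing oc.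
rewrite (off_strand_derive (underpass_not_endpoint uu) us).
by rewrite (off_strand_derive (double_endpoint oud) os).
Qed.

(** The two diagrams and the two colorings agree near the points off the core, and the
    conditions at the points of the strands are those on [v']. *)
Lemma recolor_coloring : coloring L' recolor.
Proof.
split; [exact: recolor_same|exact: recolor_near|] => o u ou.
have [us|us] := pselect (on_strand P u); first exact: recolor_crossing_strand.
exact: recolor_crossing_off.
Qed.

End LocalChange.

(** * Invariance under local moves *)

(** What is needed to replace a tangle by another one inside a colored diagram: the complement
    of the disc sees a tangle only through the ends of its strands. *)
Definition tangle_transfer k (D D' : crossing_data k) : Prop :=
  forall (X : quandle) (v : 'I_k -> nat -> X), tangle_coloring D v ->
  exists v' : 'I_k -> nat -> X, [/\ tangle_coloring D' v',
    forall j, v' j 0 = v j 0 & forall j, v' j 3 = v j 3].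

Definition tangle_determined k (D : crossing_data k) : Prop :=
  forall (X : quandle) (v w : 'I_k -> nat -> X), tangle_coloring D v ->
  tangle_coloring D w -> (forall j, v j 0 = w j 0) ->
  forall j i, (i <= 3)%N -> v j i = w j i.

Section LocalIso.
Variables (R : realType) (n m k : nat) (P : placement R n m k).
Hypothesis P_valid : valid_placement P.
Implicit Types (L : diagram R n m) (D : crossing_data k) (p q : param R n m).

Definition strands_separated L := forall p q, double_pair (curve L) p q ->
  on_strand P p -> on_strand P q.

Definition agree_off_strands L L' := forall p, in_dom p -> ~ on_strand P p ->
  curve L' p.1 p.2 = curve L p.1 p.2 /\ (underpass L' p <-> underpass L p).

Lemma agree_off_strands_sym L L' : agree_off_strands L L' -> agree_off_strands L' L.
Proof.
move=> LL' p pd ps; have [-> [h1 h2]] := LL' p pd ps; by split.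
Qed.

Lemma coloring_transfer L L' D D' : tangle_spec P L D -> tangle_spec P L' D' ->
  agree_off_strands L L' -> strands_separated L' -> tangle_transfer D D' ->
  forall (X : quandle) (c : param R n m -> X), coloring L c ->
  exists2 c', coloring L' c' & forall p, ~ on_core P (5 / 8) p -> c' p = c p.
Proof.
move=> LD LD' LL' L's DD' X c cL.
have [v' [v'D v'0 v'3]] := DD' _ _ (trace_tangle_coloring P_valid LD cL).
exists (recolor P c v'); first exact: (@recolor_coloring _ _ _ _ _ P_valid L L' D D').
by move=> p; exact: recolor_off.
Qed.

(** The colors at the left ends of the strands are read off the core. *)
Lemma coloring_unique L L' D D' (X : quandle) (c1 c2 : param R n m -> X) :
  tangle_spec P L D -> tangle_spec P L' D' -> agree_off_strands L L' ->
  tangle_determined D -> coloring L c1 -> coloring L c2 ->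
  (forall p, on_arc L p -> on_arc L' p -> ~ on_core P (5 / 8) p -> c1 p = c2 p) ->
  forall p, on_arc L p -> c1 p = c2 p.
Proof.
move=> LD LD' LL' Ddet c1L c2L c12 p pg.
have [[j [w [wI pw]]]|np] := pselect (on_core P (5 / 8) p); last first.
  by apply: c12 => //; exact/(off_core_on_arc LD LD' LL' np).
have w1 : -1 <= w <= 1 by lra.
have wg := on_arc_same pw pg; have [_ wu] := wg.
rewrite (coloring_same c1L pg pw) (coloring_same c2L pg pw).
rewrite (traceE P_valid LD c1L w1 wu) (traceE P_valid LD c2L w1 wu).
apply: (Ddet _ _ _ (trace_tangle_coloring P_valid LD c1L)
  (trace_tangle_coloring P_valid LD c2L) _ _ _ (seg_le3 w)).
move=> i; have mI := mid_bound R (isT : (0 <= 3)%N).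
have m1 : -1 <= mid R 0 <= 1 by lra.
have mg (K : diagram R n m) E : tangle_spec P K E -> on_arc K (strand_param P i (mid R 0)).
  move=> KE; split; first exact: strand_in_dom.
  move=> /(KE.1 _ _ m1)[i' [i'3 e _]]; exact: mid_bp e.
rewrite /trace; apply: c12; [exact: mg LD|exact: mg LD'|].
move=> [j' [w' [w'I mw]]]; have w'1 : -1 <= w' <= 1 by lra.
have [_ e] := strand_inj P_valid m1 w'1 mw; move: w'I; rewrite -e /mid; lra.
Qed.

(** A coloring of [L] restricts to the complement of the disc, and this restriction extends in
    exactly one way to the disc of [L']. *)
Lemma local_iso L L' D D' : tangle_spec P L D -> tangle_spec P L' D' ->
  agree_off_strands L L' -> strands_separated L -> strands_separated L' ->
  tangle_transfer D D' -> tangle_transfer D' D ->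
  tangle_determined D -> tangle_determined D' ->
  quandle_iso (fundamental_quandle L) (fundamental_quandle L').
Proof.
move=> LD LD' LL' Ls L's DD' D'D Ddet D'det.
have L'L := agree_off_strands_sym LL'.
apply: (@iso_of_transfer _ _ _ L L' (fun p q =>
  [/\ p = q, on_arc L p, on_arc L' p & ~ on_core P (5 / 8) p])).
- by move=> p q [<-].
- move=> X c cL; have [c' c'L' e] := coloring_transfer LD LD' LL' L's DD' cL.
  by exists c' => // p q [<- _ _ np]; rewrite e.
- move=> X c' c'L'; have [c cL e] := coloring_transfer LD' LD L'L Ls D'D c'L'.
  by exists c => // p q [<- _ _ np]; rewrite e.
- move=> X c1 c2 c' c1L c2L e1 e2.
  apply: (coloring_unique LD LD' LL' Ddet c1L c2L) => p pg pg' np.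
  by rewrite (e1 p p) ?(e2 p p).
- move=> X c1 c2 c c1L c2L e1 e2.
  apply: (coloring_unique LD' LD L'L D'det c1L c2L) => p pg pg' np.
  by rewrite -(e1 p p) ?(e2 p p).
Qed.

End LocalIso.

(** * Double points of a tangle *)

Lemma is_derive_pair (R : realType) (U V : normedModType R) (f : R -> U) (g : R -> V)
    (t : R) (df : U) (dg : V) :
  is_derive t 1 f df -> is_derive t 1 g dg ->
  is_derive t 1 (fun s => (f s, g s)) (df, dg).
Proof.
move=> [fd fE] [gd gE].
have fD : differentiable f t by exact/derivable1_diffP.
have gD : differentiable g t by exact/derivable1_diffP.
have hD := differentiable_pair fD gD.
split; first exact/derivable1_diffP.
by rewrite deriveE // diff_pair //= -!deriveE // fE gE.
Qed.

Section TangleGeometry.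
Variables (R : realType) (n m k : nat) (P : placement R n m k).
Variables (L : diagram R n m) (sigma : k.-tuple (R -> R * R)).
Hypothesis P_valid : valid_placement P.
Hypothesis L_sigma : contains_tangle P sigma L.
Hypothesis sigma_square : forall j (u : R), -1 <= u <= 1 -> square (tnth sigma j u).
Local Notation sp := (strand_param P).
Local Notation chart := (tangle_chart P).
Implicit Types (p q : param R n m) (j h : 'I_k) (u w : R).

(** The disc contains no point of the diagram that is off the strands, and its chart is
    injective, so that double points inside the disc are double points of the plane tangle. *)
Lemma tangle_partner p q j u : -1 <= u <= 1 -> same_param p (sp j u) ->
  double_pair (curve L) p q ->
  exists j' u', [/\ -1 <= u' <= 1, same_param q (sp j' u'),
    tnth sigma j u = tnth sigma j' u' & j = j' -> u <> u'].
Proof.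
move=> uI pu pq; have [pd qd npq e] := pq.
have [cE off _] := L_sigma; have [[_ inj _ _] _ _ _] := P_valid.
have pE : curve L p.1 p.2 = chart (tnth sigma j u).
  by rewrite (curve_same L pu) /= cE.
have [[j' [u' [u'I qu']]]|ns] := pselect (on_strand P q); last first.
  case: (off q qd ns); rewrite -e pE; exists (tnth sigma j u) => //.
  exact: sigma_square.
exists j', u'; split => //.
- apply: inj; rewrite ?inE; try exact: sigma_square.
  by rewrite -pE e (curve_same L qu') /= cE.
- move=> jj uu; apply: npq; apply: (same_param_trans pu).
  by rewrite jj uu; exact: same_param_sym.
Qed.

Lemma tangle_separated : strands_separated P L.
Proof.
move=> p q pq [j [u [uI pu]]].
by have [j' [u' [u'I qu' _ _]]] := tangle_partner uI pu pq; exists j', u'.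
Qed.

Lemma tangle_double j h u w : -1 <= u <= 1 -> -1 <= w <= 1 ->
  ~ (j = h /\ u = w) -> tnth sigma j u = tnth sigma h w ->
  double_pair (curve L) (sp j u) (sp h w).
Proof.
move=> uI wI ne e; have [cE _ _] := L_sigma.
split; try exact: (strand_in_dom P_valid).
  by move=> /(strand_inj P_valid uI wI).
by rewrite /= !cE // e.
Qed.

(** The chain rule applied to the two parametrisations of a strand, by the diagram and by the
    tangle. *)
Lemma derive1_strand j u (df : R * R) : -1 < u < 1 ->
  is_derive u 1 (tnth sigma j) df ->
  strand_rad P j *: derive1 (curve L (strand_comp P j)) (sp j u).2 =
  df.1 *: 'd chart (tnth sigma j u) (1, 0) + df.2 *: 'd chart (tnth sigma j u) (0, 1).
Proof.
move=> uI [sd sE]; have [cE _ _] := L_sigma; have [[cd _ _ _] _ _ _] := P_valid.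
have u1 : -1 <= u <= 1 by lra.
set a := strand_ctr P j; set r := strand_rad P j.
have da : is_derive u 1 (fun w => a + r * w) r.
  by apply: is_derive_eq; rewrite /GRing.scale /=; ring.
have dE : derive1 (curve L (strand_comp P j) \o (fun w => a + r * w)) u =
    r *: derive1 (curve L (strand_comp P j)) (a + r * u).
  rewrite derive1_reparam; [|by case: da|exact: curve_derivable].
  by rewrite derive1E; case: da => _ ->.
rewrite -dE (@derive1_near_eq _ _ _ (chart \o tnth sigma j)); last first.
  have : \forall w \near u, w \in `]-1, 1[ by apply: near_in_itvoo; rewrite in_itv.
  by apply: filterS => w; rewrite in_itv /= => wI; rewrite cE //; lra.
rewrite derive1_diff_comp //; last by have [] := cd _ (sigma_square j u1).
rewrite derive1E sE -!linearZ -linearD; congr ('d chart _ _).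
case: (df) => x y.
by transitivity (x * 1 + y * 0, x * 0 + y * 1); [congr (_, _); ring|].
Qed.

End TangleGeometry.

(** * Tangles of graphs *)

(** Two graphs that meet have the same abscissa there, so that a crossing involves the same
    breakpoint of its two strands. [partner i j] is the strand that [j] meets at the
    breakpoint [i], [slope i h j] tells that [j] is steeper than [h] there, and [eps h] that
    [h] is traversed forwards.  For the orientation of the strands by increasing abscissa, a
    crossing is positive when the lower strand is the steeper one. *)
Definition graph_data k (partner : nat -> 'I_k -> option 'I_k)
    (slope : nat -> 'I_k -> 'I_k -> bool) (height : 'I_k -> nat) (eps : 'I_k -> bool) :
    crossing_data k := fun j i =>
  if partner i j is Some h then
    if (height j < height h)%N then Some (h, i, eps h == slope i h j) else None
  else None.

Lemma mul_gt0_eq (R : realType) (x y : R) : x != 0 -> y != 0 ->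
  (0 < x * y) = ((0 < x) == (0 < y)).
Proof.
move=> x0 y0; have [xp|xn|/eqP] := ltrgtP x 0; last by rewrite (negbTE x0).
  by rewrite nmulr_rgt0 // lt_neqAle y0 leNgt; case: (0 < y).
by rewrite pmulr_rgt0 //; case: (0 < y).
Qed.

(** [X] is the determinant that gives the sign of a crossing, [a] and [b] are the radii of the
    upper and of the lower strand, [d] is the difference of slopes and [c] the determinant of
    the chart. *)
Lemma sign_rule (R : realType) (a b c d X : R) : 0 < c -> a != 0 -> b != 0 -> d != 0 ->
  X != 0 -> a * b * X = d * c -> (0 < X) = (((0 < a) == (0 < d)) == (0 < b)).
Proof.
move=> c0 a0 b0 d0 X0 e; have : (0 < a * b * X) = (0 < d * c) by rewrite e.
rewrite !mul_gt0_eq ?mulf_neq0 ?(gt_eqF c0) // c0.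
by do 4 case: (0 < _).
Qed.

Section GraphTangle.
Variables (R : realType) (n m k : nat) (P : placement R n m k).
Variables (L : diagram R n m) (sigma : k.-tuple (R -> R * R)).
Variables (f : 'I_k -> R -> R) (df : nat -> 'I_k -> R).
Variables (partner : nat -> 'I_k -> option 'I_k) (slope : nat -> 'I_k -> 'I_k -> bool).
Hypothesis P_valid : valid_placement P.
Hypothesis L_sigma : contains_tangle P sigma L.
Hypothesis sigma_square : forall j (u : R), -1 <= u <= 1 -> square (tnth sigma j u).
Hypothesis sigmaE : forall j u, tnth sigma j u = (u, f j u).
Hypothesis f_derive : forall j i, (i < 3)%N -> is_derive (bp R i) 1 (f j) (df i j).
Hypothesis f_meet : forall j h (u : R), -1 <= u <= 1 -> j != h ->
  f j u = f h u <-> exists i, [/\ (i < 3)%N, u = bp R i & partner i j = Some h].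
Hypothesis partner_neq : forall i j h, partner i j = Some h -> j != h.
Hypothesis slopeE : forall i j h, (i < 3)%N -> partner i j = Some h ->
  slope i h j = (0 < df i j - df i h).
Local Notation sp := (strand_param P).

Lemma graph_tangle_spec : tangle_spec P L (graph_data partner slope
  (fun j => strand_height P j) (fun j => 0 < strand_rad P j)).
Proof.
have [_ _ hts] := L_sigma.
split.
- move=> j u uI; split.
    move=> uu; have [q pq] := under_double uu.
    have [h [w [wI _ e ne]]] := tangle_partner P_valid L_sigma sigma_square uI
      (same_param_refl _) pq.
    move: (e); rewrite !sigmaE => -[uw fe]; rewrite -uw in fe e ne.
    have jh : j != h by apply/eqP => /ne.
    have [i [i3 uE pi]] := (f_meet uI jh).1 fe.
    exists i; split => //; rewrite /graph_data pi.
    by rewrite ((hts j h u u jh uI uI e).1 uu).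
  move=> [i [i3 -> {u uI}]]; rewrite /graph_data.
  case pi : (partner i j) => [h|] //; case: ifP => // lt _.
  have bI : -1 <= bp R i <= 1 by have := bp_bound R i3; lra.
  have jh := partner_neq pi.
  have fe : f j (bp R i) = f h (bp R i) by apply/(f_meet bI jh); exists i.
  by apply: (hts j h _ _ jh bI bI _).2 => //; rewrite !sigmaE fe.
move=> j i h i' b i3; rewrite /graph_data.
case pi : (partner i j) => [h'|] //; case: ifP => // lt [<- <- <-] {h i' b}.
have bI : -1 <= bp R i <= 1 by have := bp_bound R i3; lra.
have b1 : -1 < bp R i < 1 by have := bp_bound R i3; lra.
have jh := partner_neq pi; have hj : h' != j by rewrite eq_sym.
have fe : f j (bp R i) = f h' (bp R i) by apply/(f_meet bI jh); exists i.
have se : tnth sigma h' (bp R i) = tnth sigma j (bp R i) by rewrite !sigmaE fe.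
have dp : double_pair (curve L) (sp h' (bp R i)) (sp j (bp R i)).
  by apply: (tangle_double P_valid L_sigma) => // -[e _]; rewrite e eqxx in hj.
split => //.
  split=> //.
    by move=> /(hts _ _ _ _ hj bI bI se).1; rewrite ltnNge ltnW.
  exact: (hts _ _ _ _ jh bI bI (esym se)).2.
have sd h : is_derive (bp R i) 1 (tnth sigma h) (1, df i h).
  have -> : tnth sigma h = (fun u => (u, f h u)) by apply/funext => u; rewrite sigmaE.
  exact: (is_derive_pair (is_derive_id _ _) (f_derive h i3)).
have dE h := derive1_strand P_valid L_sigma sigma_square b1 (sd h).
have det0 := double_transverse dp.
set X := det3 _ _ _ in det0.
rewrite /positive_crossing -/X slopeE //.
have [[cd _ _ cpos] _ _ _] := P_valid.
have Xe : strand_rad P h' * strand_rad P j * X = (df i j - df i h') *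
   det3 ('d (tangle_chart P) (tnth sigma j (bp R i)) (1, 0))
        ('d (tangle_chart P) (tnth sigma j (bp R i)) (0, 1))
        (tangle_chart P (tnth sigma j (bp R i))).
  rewrite /X -det3Z !dE se det3_lincomb /= !mul1r mulr1; congr (_ * det3 _ _ _).
  by have [-> //] := L_sigma; rewrite se.
have c0 := cpos _ (sigma_square j bI).
have r1 := strand_rad_neq0 P_valid h'; have r2 := strand_rad_neq0 P_valid j.
apply: (sign_rule c0 r1 r2 _ det0 Xe).
apply/eqP => d0; move/eqP: Xe; rewrite d0 mul0r !mulf_eq0.
by rewrite (negbTE r1) (negbTE r2) (negbTE det0).
Qed.

End GraphTangle.

(** * Sweeping a tangle from left to right *)

Section Sweep.
Variables (k : nat) (D : crossing_data k) (X : quandle).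
Implicit Types (s : 'I_k -> X) (v : 'I_k -> nat -> X).

Definition synchronous : Prop := forall j i h i' b, D j i = Some (h, i', b) -> i' = i.

Fixpoint sweep s (i : nat) : 'I_k -> X :=
  if i is i'.+1 then
    fun j => if D j i' is Some (h, _, b) then qpow b (sweep s i' j) (sweep s i' h)
             else sweep s i' j
  else s.

Hypothesis D_sync : synchronous.

Lemma sweep_coloring s : tangle_coloring D (fun j i => sweep s i j).
Proof.
move=> j i _ /=; case Dji : (D j i) => [[[h i'] b]|] //.
by rewrite (D_sync Dji).
Qed.

Lemma coloring_sweep v : tangle_coloring D v ->
  forall i j, (i <= 3)%N -> v j i = sweep (v^~ 0%N) i j.
Proof.
move=> vD; elim=> [//|i IH] j i3; rewrite vD //=.
case Dji : (D j i) => [[[h i'] b]|]; last by rewrite IH // ltnW.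
by rewrite (D_sync Dji) !IH // ltnW.
Qed.

End Sweep.

Lemma sweep_ext k (D : crossing_data k) (X : quandle) (s s' : 'I_k -> X) :
  s =1 s' -> forall i, sweep D s i =1 sweep D s' i.
Proof.
by move=> ss; elim=> [//|i IH] j /=; case: (D j i) => [[[h i'] b]|]; rewrite !IH.
Qed.

Lemma synchronous_determined k (D : crossing_data k) : synchronous D -> tangle_determined D.
Proof.
move=> Ds X v w vD wD vw j i i3.
by rewrite (coloring_sweep Ds vD) // (coloring_sweep Ds wD) //; exact: sweep_ext.
Qed.

Lemma synchronous_transfer k (D D' : crossing_data k) :
  synchronous D -> synchronous D' ->
  (forall (X : quandle) (s : 'I_k -> X), sweep D s 3 =1 sweep D' s 3) ->
  tangle_transfer D D'.
Proof.
move=> Ds D's DD' X v vD; exists (fun j i => sweep D' (v^~ 0%N) i j).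
split; [exact: sweep_coloring| by []|] => j.
by rewrite (coloring_sweep Ds vD) // DD'.
Qed.

Lemma graph_data_synchronous k partner slope height eps :
  synchronous (@graph_data k partner slope height eps).
Proof.
move=> j i h i' b; rewrite /graph_data; case: partner => // h'.
by case: ifP => // _ [_ <-].
Qed.

(** The colorings of both tangles are computed by sweeping from left to right; hence it suffices
    that the two sweeps give the same colors at the right ends. *)
Lemma graph_iso (R : realType) (n m k : nat) (P : placement R n m k)
    (L L' : diagram R n m) (D D' : crossing_data k) (sigma sigma' : k.-tuple (R -> R * R)) :
  valid_placement P -> contains_tangle P sigma L -> contains_tangle P sigma' L' ->
  (forall j (u : R), -1 <= u <= 1 -> square (tnth sigma j u)) ->
  (forall j (u : R), -1 <= u <= 1 -> square (tnth sigma' j u)) ->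
  agree_off_strands P L L' -> tangle_spec P L D -> tangle_spec P L' D' ->
  synchronous D -> synchronous D' ->
  (forall (X : quandle) (s : 'I_k -> X), sweep D s 3 =1 sweep D' s 3) ->
  quandle_iso (fundamental_quandle L) (fundamental_quandle L').
Proof.
move=> PV Ls L's sq sq' LL' LD L'D' Ds D's DD'.
apply: (local_iso PV LD L'D' LL').
- exact: tangle_separated sq.
- exact: tangle_separated sq'.
- exact: synchronous_transfer.
- by apply: synchronous_transfer => // X s j; rewrite DD'.
- exact: synchronous_determined.
- exact: synchronous_determined.
Qed.

(** * The bump function *)

Section Bump.
Variable R : realType.
Implicit Types u w : R.

Lemma bump_fun_ge0 u : 0 <= bump_fun u.
Proof. by rewrite /bump_fun mulr_ge0 ?sqr_ge0 //; lra. Qed.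

Lemma bump_fun_le u : -1 <= u <= 1 -> bump_fun u <= 16 / 9.
Proof.
move=> uI; rewrite /bump_fun; have u2 : u ^+ 2 <= 1 by nra.
have : 0 <= u ^+ 2 * (2 - u ^+ 2) by rewrite mulr_ge0 ?sqr_ge0 //; lra.
lra.
Qed.

Lemma bump_funN u : bump_fun (- u) = bump_fun u.
Proof. by rewrite /bump_fun sqrrN. Qed.

Lemma bump_fun_eq1 u : -1 <= u <= 1 -> bump_fun u = 1 -> u = - (1 / 2) \/ u = 1 / 2.
Proof.
move=> uI; rewrite /bump_fun => e.
have e2 : (u + 1 / 2) * (u - 1 / 2) * (7 / 4 - u ^+ 2) = 0 by lra.
have ne : 0 < 7 / 4 - u ^+ 2 by nra.
move/eqP: e2; rewrite !mulf_eq0 (gt_eqF ne) orbF => /orP[] /eqP; [left|right]; lra.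
Qed.

Lemma bump_fun_half :
  (bump_fun (- (1 / 2) : R) = 1) * (bump_fun (1 / 2 : R) = 1).
Proof. by rewrite /bump_fun; split; field. Qed.

(** The polynomial [9 / 16 * (bump_fun u - 2 * u)] has the root [1 / 2]; its cofactor is negative
    on [[-1, 1]]. *)
Lemma bump_fun_eq2 u : -1 <= u <= 1 -> bump_fun u = 2 * u -> u = 1 / 2.
Proof.
move=> uI; rewrite /bump_fun => e.
have e2 : (u - 1 / 2) * (8 * u ^+ 3 + 4 * u ^+ 2 - 14 * u - 16) = 0 by lra.
have u2 : u ^+ 2 <= 1 by nra.
have ne : 8 * u ^+ 3 + 4 * u ^+ 2 - 14 * u - 16 < 0.
  rewrite exprSr; have [u0|u0] := lerP 0 u; first nra.
  have [u1|u1] := lerP u (- (1 / 2)); last nra.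
  have : u ^+ 2 * (1 + 2 * u) <= 0 by rewrite mulr_ge0_le0 ?sqr_ge0 //; lra.
  lra.
by move/eqP: e2; rewrite mulf_eq0 (lt_eqF ne) orbF => /eqP; lra.
Qed.

Lemma bump_fun_inj u w : -1 <= u <= 1 -> -1 <= w <= 1 -> bump_fun u = bump_fun w ->
  w = u \/ w = - u.
Proof.
move=> uI wI; rewrite /bump_fun => e.
have e2 : (1 - u ^+ 2) = (1 - w ^+ 2).
  have : (1 - u ^+ 2) ^+ 2 = (1 - w ^+ 2) ^+ 2 by lra.
  by move/eqP; rewrite eqrXn2 //; [move/eqP|nra|nra].
have e3 : (w - u) * (w + u) = 0 by nra.
by move/eqP: e3; rewrite mulf_eq0 => /orP[] /eqP; [left|right]; lra.
Qed.

Lemma bump_fun_derive u : is_derive u 1 (@bump_fun R) (- (64 / 9) * u * (1 - u ^+ 2)).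
Proof.
rewrite /bump_fun; apply: is_derive_eq.
rewrite /GRing.scale /=.
by field.
Qed.

End Bump.

(** * The third Reidemeister move *)

Definition o0 : 'I_3 := @Ordinal 3 0 isT.
Definition o1 : 'I_3 := @Ordinal 3 1 isT.
Definition o2 : 'I_3 := @Ordinal 3 2 isT.

Lemma ord3_ind (Q : 'I_3 -> Prop) : Q o0 -> Q o1 -> Q o2 -> forall j, Q j.
Proof.
by move=> q0 q1 q2 [[|[|[|//]]] jP]; rewrite (bool_irrelevance jP isT).
Qed.

Definition R3_partner (i : nat) (j : 'I_3) : option 'I_3 :=
  match i, val j with
  | 0, 1 => Some o2 | 0, 2 => Some o1
  | 1, 0 => Some o1 | 1, 1 => Some o0
  | 2, 0 => Some o2 | 2, 2 => Some o0
  | _, _ => None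
  end%N.

Definition R3_slope (i : nat) (h j : 'I_3) : bool :=
  match val h, val j with 1, 0 | 2, 0 | 1, 2 => true | _, _ => false end%N.

(** Only the color of the bottom strand is in question.  In one sweep this strand passes under
    the middle strand first, and in the other one under the top strand; the middle strand has,
    where it passes over the bottom strand, its initial color in one sweep and this color
    translated by that of the top strand in the other.  The results agree because the
    translation by the color of the top strand is an automorphism. *)
Lemma R3_sweep (ht : 'I_3 -> nat) (eps : 'I_3 -> bool) (X : quandle) (s : 'I_3 -> X) :
  injective ht ->
  sweep (graph_data R3_partner R3_slope ht eps) s 3 =1
  sweep (graph_data (fun i => R3_partner (2 - i)) R3_slope ht eps) s 3.
Proof.
move=> htI.
have h01 : ht o0 != ht o1 by apply/eqP => /htI.
have h02 : ht o0 != ht o2 by apply/eqP => /htI.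
have h12 : ht o1 != ht o2 by apply/eqP => /htI.
have n01 : (ht o0 < ht o1)%N = ~~ (ht o1 < ht o0)%N by lia.
have n02 : (ht o0 < ht o2)%N = ~~ (ht o2 < ht o0)%N by lia.
have n12 : (ht o1 < ht o2)%N = ~~ (ht o2 < ht o1)%N by lia.
(* The six orders of the heights, for each strand. *)
elim/ord3_ind; rewrite /= /graph_data /=.
all: case b10 : (ht o1 < ht o0)%N; case b20 : (ht o2 < ht o0)%N;
  case b21 : (ht o2 < ht o1)%N; try (exfalso; lia).
all: do 4 rewrite /= ?n01 ?n02 ?n12 ?b10 ?b20 ?b21.
all: rewrite /R3_slope /= ?eqb_id ?eqbF_neg.
all: try done.
all: try by rewrite qpow_dist.
all: try by rewrite -qpow_dist.
all: try by rewrite [RHS]qpow_dist ?qpowK ?qpowNK.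
all: try by rewrite [LHS]qpow_dist ?qpowK ?qpowNK.
Qed.

Lemma R3_partner_neq i j h : R3_partner i j = Some h -> j != h.
Proof. by case: i => [|[|[|i]]]; elim/ord3_ind: j => // -[<-]. Qed.

Lemma R3_partner_inj i i' j h :
  R3_partner i j = Some h -> R3_partner i' j = Some h -> i = i'.
Proof.
by case: i => [|[|[|i]]]; case: i' => [|[|[|i']]]; elim/ord3_ind: j => // -[<-].
Qed.

Section R3.
Variables (R : realType) (n m : nat).
Implicit Types (L : diagram R n m).

Section R3Tangle.
Variables (flip : bool) (P : placement R n m 3) (L : diagram R n m).
Variable sigma : 3.-tuple (R -> R * R).
Hypothesis P_valid : valid_placement P.
Hypothesis L_sigma : contains_tangle P sigma L.
Hypothesis sigma0 : forall u, tnth sigma o0 u = (u, u / 2).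
Hypothesis sigma1 : forall u, tnth sigma o1 u = (u, - u / 2).
Hypothesis sigma2 : forall u, tnth sigma o2 u = (u, (-1) ^+ flip * (bump_fun u / 4)).

Let f (j : 'I_3) (u : R) : R :=
  match val j with
  | O => u / 2 | S O => - u / 2 | _ => (-1) ^+ flip * (bump_fun u / 4)
  end.

Let df (i : nat) (j : 'I_3) : R :=
  match val j with
  | O => 1 / 2 | S O => - (1 / 2)
  | _ => (-1) ^+ flip * (- (16 / 9) * bp R i * (1 - bp R i ^+ 2))
  end.

Let partner (i : nat) := R3_partner (if flip then (2 - i)%N else i).

Lemma R3_sigmaE j u : tnth sigma j u = (u, f j u).
Proof. by elim/ord3_ind: j; rewrite ?sigma0 ?sigma1 ?sigma2. Qed.

Lemma R3_square j u : -1 <= u <= 1 -> square (tnth sigma j u).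
Proof.
move=> uI; rewrite R3_sigmaE; split => //=.
have b0 := bump_fun_ge0 u; have b1 := bump_fun_le uI.
by elim/ord3_ind: j; rewrite /f /=; [lra|lra|case: flip; rewrite ?expr0 ?expr1; lra].
Qed.

Lemma R3_derive j i : (i < 3)%N -> is_derive (bp R i) 1 (f j) (df i j).
Proof.
move=> _; elim/ord3_ind: j; rewrite /f /df /=.
- by apply: is_derive_eq; rewrite /GRing.scale /=; field.
- by apply: is_derive_eq; rewrite /GRing.scale /=; field.
- have db := bump_fun_derive (bp R i).
  by apply: is_derive_eq; rewrite /GRing.scale /=; field.
Qed.

Lemma R3_meet j h (u : R) : -1 <= u <= 1 -> j != h ->
  f j u = f h u <-> exists i, [/\ (i < 3)%N, u = bp R i & partner i j = Some h].
Proof.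
move=> uI jh.
have uNI : -1 <= - u <= 1 by lra.
have root i0 : (i0 < 3)%N -> (f j u = f h u <-> u = bp R i0) -> partner i0 j = Some h ->
    f j u = f h u <-> exists i, [/\ (i < 3)%N, u = bp R i & partner i j = Some h].
  move=> i03 e p; split; first by move=> /e ui; exists i0.
  move=> [i [i3 ui pi]]; apply/e; rewrite ui; congr (bp R _).
  by move: pi p; rewrite /partner => /R3_partner_inj h1 /h1; case: flip; lia.
have m01 : u / 2 = - u / 2 <-> u = bp R 1 by rewrite bpE; split; lra.
have b2 : (u = 1 / 2 -> bump_fun u = 1) /\ (u = - (1 / 2) -> bump_fun u = 1).
  by split=> ->; rewrite bump_fun_half.
have m02 : u / 2 = (-1) ^+ flip * (bump_fun u / 4) <-> u = bp R (if flip then 0 else 2)%N.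
  case: flip; rewrite bpE ?expr0 ?expr1; split => [e|uE].
  - by have := bump_fun_eq2 uNI; rewrite bump_funN => /(_ ltac:(lra)); lra.
  - by have := b2.2 uE; lra.
  - by apply: bump_fun_eq2 => //; lra.
  - by have := b2.1 uE; lra.
have m12 : - u / 2 = (-1) ^+ flip * (bump_fun u / 4) <-> u = bp R (if flip then 2 else 0)%N.
  case: flip; rewrite bpE ?expr0 ?expr1; split => [e|uE].
  - by apply: bump_fun_eq2 => //; lra.
  - by have := b2.1 uE; lra.
  - by have := bump_fun_eq2 uNI; rewrite bump_funN => /(_ ltac:(lra)); lra.
  - by have := b2.2 uE; lra.
have sym (x y : R) (Q : Prop) : (x = y <-> Q) -> (y = x <-> Q).
  by move=> [e1 e2]; split => [/esym|/e2].
move: m01 m02 m12 root jh; rewrite /f /partner; case: flip => m01 m02 m12.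
all: elim/ord3_ind: j; elim/ord3_ind: h => // root _.
(* The breakpoint at which [j] and [h] meet is found by computing [R3_partner]. *)
all: first [apply: (root 0%N isT _ erefl) | apply: (root 1%N isT _ erefl)
           | apply: (root 2%N isT _ erefl)].
all: first [exact: m01 | exact: m02 | exact: m12
           | exact: sym m01 | exact: sym m02 | exact: sym m12].
Qed.

Lemma R3_slopeE i j h : (i < 3)%N -> partner i j = Some h ->
  R3_slope i h j = (0 < df i j - df i h).
Proof.
rewrite /partner /df; case: flip; case: i => [|[|[|//]]] _; elim/ord3_ind: j => //= -[<-].
all: rewrite /R3_slope /= ?bpE ?expr0 ?expr1; apply/esym.
all: first [apply/negbTE; rewrite -leNgt; lra | apply/idP; lra].
Qed.

Lemma R3_tangle_spec : tangle_spec P L (graph_data partner R3_slope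
  (fun j => strand_height P j) (fun j => 0 < strand_rad P j)).
Proof.
apply: (graph_tangle_spec P_valid L_sigma R3_square R3_sigmaE R3_derive R3_meet _ R3_slopeE).
by move=> i j h; rewrite /partner => /R3_partner_neq.
Qed.

End R3Tangle.

Lemma R3_iso L L' : R3_move L L' ->
  quandle_iso (fundamental_quandle L) (fundamental_quandle L').
Proof.
move=> [P [PV Ls L's LL']].
have s2 u : bump_fun u / 4 = (-1) ^+ false * (bump_fun u / 4) :> R by rewrite mul1r.
have s2' u : - bump_fun u / 4 = (-1) ^+ true * (bump_fun u / 4) :> R by rewrite expr1; ring.
have LD := @R3_tangle_spec false P L _ PV Ls (fun _ => erefl) (fun _ => erefl)
  (fun u => congr1 (pair u) (s2 u)).
have L'D := @R3_tangle_spec true P L' _ PV L's (fun _ => erefl) (fun _ => erefl)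
  (fun u => congr1 (pair u) (s2' u)).
apply: (graph_iso PV Ls L's _ _ LL' LD L'D); try exact: graph_data_synchronous.
- apply: (@R3_square false) => // u; exact: (congr1 (pair u) (s2 u)).
- apply: (@R3_square true) => // u; exact: (congr1 (pair u) (s2' u)).
- by move=> X s; apply: R3_sweep => i j /val_inj /perm_inj.
Qed.

End R3.

(** * The second and first Reidemeister moves *)

Definition no_crossings k : crossing_data k := fun _ _ => None.

Lemma no_crossings_synchronous k : synchronous (@no_crossings k).
Proof. by []. Qed.

(** A strand in an embedded tangle has no double point. *)
Lemma no_crossings_spec (R : realType) (n m k : nat) (P : placement R n m k)
    (L : diagram R n m) (sigma : k.-tuple (R -> R * R)) :
  valid_placement P -> contains_tangle P sigma L ->
  (forall j (u : R), -1 <= u <= 1 -> square (tnth sigma j u)) ->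
  (forall j h (u w : R), tnth sigma j u = tnth sigma h w -> j = h /\ u = w) ->
  tangle_spec P L (@no_crossings k).
Proof.
move=> PV Ls sq inj; split => // j u uI; split; last by move=> [i []].
move=> uu; have [q pq] := under_double uu.
have [h [w [wI _ e ne]]] := tangle_partner PV Ls sq uI (same_param_refl _) pq.
by have [jh uw] := inj _ _ _ _ e; case: (ne jh).
Qed.

Section R2.
Variables (R : realType) (n m : nat).

Definition p0 : 'I_2 := @Ordinal 2 0 isT.
Definition p1 : 'I_2 := @Ordinal 2 1 isT.

Lemma ord2_ind (Q : 'I_2 -> Prop) : Q p0 -> Q p1 -> forall j, Q j.
Proof.
by move=> q0 q1 [[|[|//]] jP]; rewrite (bool_irrelevance jP isT).
Qed.

Definition R2_partner (i : nat) (j : 'I_2) : option 'I_2 :=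
  if i is 1%N then None else Some (if val j is 0%N then p1 else p0).

Definition R2_slope (i : nat) (h j : 'I_2) : bool :=
  match i, val j with 0, 0 | 2, 1 => true | _, _ => false end%N.

(** The lower strand passes under the upper one twice in a row, with opposite signs. *)
Lemma R2_sweep (ht : 'I_2 -> nat) (eps : 'I_2 -> bool) (X : quandle) (s : 'I_2 -> X) :
  injective ht ->
  sweep (@no_crossings 2) s 3 =1 sweep (graph_data R2_partner R2_slope ht eps) s 3.
Proof.
move=> htI; have h01 : ht p0 != ht p1 by apply/eqP => /htI.
have n01 : (ht p0 < ht p1)%N = ~~ (ht p1 < ht p0)%N by lia.
elim/ord2_ind; rewrite /= /graph_data /= ?n01; case b10 : (ht p1 < ht p0)%N.
all: do 3 rewrite /= ?n01 ?b10.
all: by rewrite /R2_slope /= ?eqb_id ?eqbF_neg ?qpowK ?qpowNK.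
Qed.

Section R2Tangle.
Variables (P : placement R n m 2) (L : diagram R n m) (sigma : 2.-tuple (R -> R * R)).
Hypothesis P_valid : valid_placement P.
Hypothesis L_sigma : contains_tangle P sigma L.
Hypothesis sigma0 : forall u, tnth sigma p0 u = (u, 0).
Hypothesis sigma1 : forall u, tnth sigma p1 u = (u, (1 - bump_fun u) / 2).

Let f (j : 'I_2) (u : R) : R := if val j is O then 0 else (1 - bump_fun u) / 2.

Let df (i : nat) (j : 'I_2) : R :=
  if val j is O then 0 else 32 / 9 * bp R i * (1 - bp R i ^+ 2).

Lemma R2_sigmaE j u : tnth sigma j u = (u, f j u).
Proof. by elim/ord2_ind: j; rewrite ?sigma0 ?sigma1. Qed.

Lemma R2_square j u : -1 <= u <= 1 -> square (tnth sigma j u).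
Proof.
move=> uI; rewrite R2_sigmaE; split => //=.
have b0 := bump_fun_ge0 u; have b1 := bump_fun_le uI.
by elim/ord2_ind: j; rewrite /f /=; lra.
Qed.

Lemma R2_derive j i : (i < 3)%N -> is_derive (bp R i) 1 (f j) (df i j).
Proof.
move=> _; elim/ord2_ind: j; rewrite /f /df /=; first exact: is_derive_cst.
have db := bump_fun_derive (bp R i).
by apply: is_derive_eq; rewrite /GRing.scale /=; field.
Qed.

Lemma R2_meet j h (u : R) : -1 <= u <= 1 -> j != h ->
  f j u = f h u <-> exists i, [/\ (i < 3)%N, u = bp R i & R2_partner i j = Some h].
Proof.
move=> uI jh.
have -> : (f j u = f h u) = (bump_fun u = 1).
  apply/propext; move: jh; rewrite /f; elim/ord2_ind: j; elim/ord2_ind: h => //= _;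
    by split; lra.
split=> [/(bump_fun_eq1 uI)[]->|[i [i3 -> pi]]].
- by exists 0%N; rewrite bpE; split => //; move: jh; elim/ord2_ind: j; elim/ord2_ind: h.
- by exists 2%N; rewrite bpE; split => //; move: jh; elim/ord2_ind: j; elim/ord2_ind: h.
- by case: i i3 pi => [|[|[|//]]] _ // _; rewrite bpE bump_fun_half.
Qed.

Lemma R2_slopeE i j h : (i < 3)%N -> R2_partner i j = Some h ->
  R2_slope i h j = (0 < df i j - df i h).
Proof.
rewrite /df; case: i => [|[|[|//]]] _; elim/ord2_ind: j => //= -[<-].
all: rewrite /R2_slope /= ?bpE; apply/esym.
all: first [apply/negbTE; rewrite -leNgt; lra | apply/idP; lra].
Qed.

Lemma R2_tangle_spec : tangle_spec P L (graph_data R2_partner R2_slope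
  (fun j => strand_height P j) (fun j => 0 < strand_rad P j)).
Proof.
apply: (graph_tangle_spec P_valid L_sigma R2_square R2_sigmaE R2_derive R2_meet _ R2_slopeE).
by move=> [|[|i]] j h; elim/ord2_ind: j => // -[<-].
Qed.

End R2Tangle.

Lemma R2_iso (L L' : diagram R n m) : R2_move L L' ->
  quandle_iso (fundamental_quandle L) (fundamental_quandle L').
Proof.
move=> [P [PV Ls L's LL']].
set sigma := [tuple _; _] in Ls.
have sq j (u : R) : -1 <= u <= 1 -> square (tnth sigma j u).
  by move=> uI; elim/ord2_ind: j; split=> //; rewrite /sigma /=; lra.
have LD : tangle_spec P L (@no_crossings 2).
  apply: (no_crossings_spec PV Ls sq) => j h u w.
  elim/ord2_ind: j; elim/ord2_ind: h => -[->] // e; exfalso; move: e; lra.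
have L'D := R2_tangle_spec PV L's (fun _ => erefl) (fun _ => erefl).
apply: (graph_iso PV Ls L's sq _ LL' LD L'D).
- by apply: R2_square.
- exact: no_crossings_synchronous.
- exact: graph_data_synchronous.
- by move=> X s; apply: R2_sweep => i j /val_inj /perm_inj.
Qed.

End R2.

Section R1.
Variables (R : realType) (n m : nat).

(** The curl crosses itself at its breakpoints 0 and 2, of which [a] is the lower one. *)
Definition curl_data (a : nat) (b : bool) : crossing_data 1 :=
  fun j i => if i == a then Some (j, (2 - a)%N, b) else None.

(** The strand passes under itself next to the segment that lies above, so that the relation
    has the form [z = x |> x] or [z = x |> z] up to an exponent; both mean [z = x]. *)
Lemma curl_coloring a b (X : quandle) (v : 'I_1 -> nat -> X) :
  a = 0%N \/ a = 2%N -> tangle_coloring (curl_data a b) v ->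
  forall j i, (i <= 3)%N -> v j i = v j 0%N.
Proof.
move=> a02 vD j; have := vD j 0%N isT; have := vD j 1%N isT; have := vD j 2%N isT.
case: a02 => -> /=; rewrite /curl_data /=.
  move=> e3 e2 e1.
  have {}e1 : v j 1%N = v j 0%N.
    by apply: (@qpow_inj X b (v j 1%N)); rewrite /= qpow_idem {1}e1 -e2.
  by case=> [|[|[|[|//]]]] _; rewrite ?e3 ?e2 ?e1.
move=> e3 e2 e1.
have {}e3 : v j 3%N = v j 0%N by rewrite e3 e2 e1 qpow_idem.
by case=> [|[|[|[|//]]]] _; rewrite ?e3 ?e2 ?e1.
Qed.

Lemma constant_coloring a b (X : quandle) (x : 'I_1 -> X) :
  tangle_coloring (curl_data a b) (fun j _ => x j).
Proof. by move=> j i _; rewrite /curl_data; case: ifP => // _; rewrite qpow_idem. Qed.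

Lemma R1_iso (L L' : diagram R n m) : R1_move L L' ->
  quandle_iso (fundamental_quandle L) (fundamental_quandle L').
Proof.
move=> [P [PV Ls L's LL']].
set sigma := [tuple _] in Ls; set sigma' := [tuple _] in L's.
have sq j (u : R) : -1 <= u <= 1 -> square (tnth sigma j u).
  by move=> uI; rewrite (ord1 j); split=> //; rewrite /sigma /=; lra.
have s'E j u : tnth sigma' j u = (u * (1 - bump_fun u), bump_fun u / 2).
  by rewrite (ord1 j).
have sq' j (u : R) : -1 <= u <= 1 -> square (tnth sigma' j u).
  move=> uI; rewrite s'E; have b0 := bump_fun_ge0 u; have b1 := bump_fun_le uI.
  split=> /=; [nra|lra].
have LD : tangle_spec P L (@no_crossings 1).
  apply: (no_crossings_spec PV Ls sq) => j h u w.
  by rewrite (ord1 j) (ord1 h) => -[->].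
have meet j h u w : -1 <= u <= 1 -> -1 <= w <= 1 -> u <> w ->
    tnth sigma' j u = tnth sigma' h w -> (u = bp R 0 /\ w = bp R 2) \/ (u = bp R 2 /\ w = bp R 0).
  move=> uI wI uw; rewrite !s'E => -[e1 e2].
  have [wu|wu] : w = u \/ w = - u by apply: bump_fun_inj => //; lra.
    by case: uw.
  have be : u * (1 - bump_fun u) = 0 by move: e1; rewrite wu bump_funN; lra.
  have u0 : u != 0 by apply/eqP => u0; apply: uw; rewrite wu u0 oppr0.
  have b1 : bump_fun u = 1.
    by move/eqP: be; rewrite mulf_eq0 (negbTE u0) => /eqP; lra.
  by rewrite wu !bpE; case: (bump_fun_eq1 uI b1) => ->; [left|right]; split; lra.
pose sp := strand_param P ord0.
have bI i : (i < 3)%N -> -1 <= bp R i <= 1 by move=> /(bp_bound R); lra.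
have dp : double_pair (curve L') (sp (bp R 0)) (sp (bp R 2)).
  apply: (tangle_double PV L's); [exact: bI|exact: bI|rewrite !bpE; lra|].
  by rewrite !s'E !bpE !bump_fun_half !subrr !mulr0.
(* Either end of the curl may be the lower one. *)
have [a [a02 ua na]] : exists a, [/\ a = 0%N \/ a = 2%N,
    underpass L' (sp (bp R a)) & ~ underpass L' (sp (bp R (2 - a)%N))].
  have ex := under_exactly_one dp.
  have [u0|u0] := pselect (underpass L' (sp (bp R 0))).
    by exists 0%N; split; [left|exact: u0|exact/ex].
  exists 2%N; split; [right| |exact: u0] => //.
  by apply: contrapT => u2; apply/u0/ex.
have a3 : (a < 3)%N by case: a02 => ->.
have a3' : (2 - a < 3)%N by case: a02 => ->.
have dpa : double_pair (curve L') (sp (bp R (2 - a)%N)) (sp (bp R a)).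
  by case: a02 => -> //; exact: double_pair_sym.
(* Idempotence holds for both exponents, so that either sign will do. *)
pose b := positive_crossing L' (sp (bp R (2 - a)%N)) (sp (bp R a)) == (0 < strand_rad P ord0).
have L'D : tangle_spec P L' (curl_data a b).
  split.
    move=> j u uI; rewrite (ord1 j); split.
      move=> uu; have [q pq] := under_double uu.
      have [h [w [wI _ e ne]]] := tangle_partner PV L's sq' uI (same_param_refl _) pq.
      have uw : u <> w by apply: ne; rewrite (ord1 h).
      exists a; rewrite /curl_data eqxx; split => //.
      have := meet _ _ _ _ uI wI uw e.
      by case: a02 na => -> na [] [uE _] //; case: na; rewrite -uE.
    move=> [i [i3 ->]]; rewrite /curl_data; case: eqP => // -> _; exact: ua.
  move=> j i h i' b' i3; rewrite /curl_data; case: eqP => // -> [<- <- <-].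
  rewrite (ord1 j) -/sp; split => //.
  by rewrite /b; case: positive_crossing; case: (0 < strand_rad P ord0).
apply: (local_iso PV LD L'D LL').
- exact: tangle_separated sq.
- exact: tangle_separated sq'.
- move=> X v vD; exists (fun j _ => v j 0%N); split => //; first exact: constant_coloring.
  by move=> j; rewrite !vD.
- move=> X v vD; exists (fun j _ => v j 0%N); split => // j.
  by rewrite (curl_coloring a02 vD).
- exact: synchronous_determined (@no_crossings_synchronous 1).
- move=> X v w vD wD vw j i i3.
  by rewrite (curl_coloring a02 vD) // (curl_coloring a02 wD).
Qed.

End R1.

(** * Invariance of the fundamental quandle *)

Theorem theorem3p2 (R : realType) (n m : nat) (L L' : diagram R n m) :
  equivalent L L' ->
  quandle_iso (fundamental_quandle L) (fundamental_quandle L').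
Proof.
elim=> {L L'} [L L' [|[|[|[|]]]]|L|L L' _|L1 L2 L3 _ IH12 _ IH23].
- exact: reparametrisation_iso.
- exact: isotopy_iso.
- exact: R1_iso.
- exact: R2_iso.
- exact: R3_iso.
- exact: quandle_iso_refl.
- exact: quandle_iso_sym.
- exact: quandle_iso_trans IH12 IH23.
Qed.
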